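(* The algebra $K_n$ is normally separated; that is, for every pair $P\subsetneq Q$ of distinct prime ideals of $K_n$ there exists an element of $Q\setminus P$ whose (nonzero) coset is normal in $K_n/P$.
   Context: Let $k$ be a field of arbitrary characteristic and $n\ge 1$. All algebras are associative and unital. Let $p_1,\dots,p_n,q_1,\dots,q_n\in k^\times$ with $p_i\ne q_i$ for all $i$, and let $\Gamma=(\gamma_{i,j})\in M_n(k^\times)$ with $\gamma_{j,i}=\gamma_{i,j}^{-1}$ and $\gamma_{i,i}=1$ for all $i,j$. $K_n$ is the $k$-algebra generated by $x_1,y_1,\dots,x_n,y_n$ subject to the relations: $y_iy_j=\gamma_{i,j}y_jy_i$ for all $i,j$; $x_iy_j=p_j\gamma_{j,i}y_jx_i$ for $i<j$; $x_iy_j=q_j\gamma_{j,i}y_jx_i$ for $i>j$; $x_ix_j=q_ip_j^{-1}\gamma_{i,j}x_jx_i$ for $i<j$; $x_iy_i=q_iy_ix_i+\sum_{\ell<i}(q_\ell-p_\ell)y_\ell x_\ell$ for all $i$. Standing assumption: $p_iq_i^{-1}$ is not a root of unity for each $i\in\{1,\dots,n\}$. An element $z$ of a ring $R$ is normal if $zR=Rz$. *)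

(* Defs.v *)
From HB Require Import structures.
From mathcomp Require Import all_boot all_algebra.
From mathcomp Require Import finmap.
From mathcomp.multinomials Require Import monalg.
From mathcomp Require Import boolp classical_sets.

Set Implicit Arguments.
Unset Strict Implicit.
Unset Printing Implicit Defensive.

Import GRing.Theory.
Local Open Scope classical_set_scope.
Local Open Scope quotient_scope.
Local Open Scope ring_scope.

(* Allows [I x] when [I] is an [ideal]: ideal >-> set >-> Funclass. *)
Identity Coercion set_fun : set >-> Funclass.

Definition two_sided_ideal (R : pzRingType) (I : set R) : Prop :=
  [/\ I 0, forall x y, I x -> I y -> I (x + y)
    & forall a x b, I x -> I (a * x * b)].

Record ideal (R : pzRingType) := Ideal {
  ideal_set :> set R;
  ideal_two_sided : two_sided_ideal ideal_set }.

Section RingQuotient.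
Variables (R : pzRingType) (I : ideal R).

Lemma ideal0 : I 0. Proof. by case: (ideal_two_sided I). Qed.

Lemma idealD x y : I x -> I y -> I (x + y).
Proof. by case: (ideal_two_sided I) => _ + _; exact. Qed.

Lemma idealMlr a x b : I x -> I (a * x * b).
Proof. by case: (ideal_two_sided I) => _ _; exact. Qed.

Lemma idealMl a x : I x -> I (a * x).
Proof. by move=> Ix; rewrite -[a * x]mulr1; exact: idealMlr. Qed.

Lemma idealMr x b : I x -> I (x * b).
Proof. by move=> Ix; rewrite -[x]mul1r; exact: idealMlr. Qed.

Lemma idealN x : I x -> I (- x).
Proof. by move=> Ix; rewrite -mulN1r; exact: idealMl. Qed.

Definition ideal_pred : R -> bool := fun x => `[< I x >].

Lemma ideal_predE x : (x \in (ideal_pred : {pred R})) = `[< I x >]. Proof. by []. Qed.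

Lemma ideal_pred_zmod_closed : zmod_closed ideal_pred.
Proof.
split=> [|x y]; rewrite !ideal_predE; first exact/asboolP/ideal0.
move=> /asboolP Ix /asboolP Iy; apply/asboolP.
by apply: idealD => //; exact: idealN.
Qed.

HB.instance Definition _ :=
  GRing.isZmodClosed.Build R ideal_pred ideal_pred_zmod_closed.

Definition ideal_zmod : zmodClosed R := GRing.ZmodClosed.clone R ideal_pred _.

(* The ring [{ideal_quot _}] of ring_quotient is restricted to commutative
   rings and proper ideals; only its additive part is reused here. *)
Definition ring_quot : Type := Quotient.quot ideal_zmod.

HB.instance Definition _ := GRing.Zmodule.on ring_quot.

Definition quot_proj (x : R) : ring_quot := \pi_(Quotient.quot ideal_zmod) x.

Definition quot_repr (x : ring_quot) : R :=
  repr (x : Quotient.quot ideal_zmod).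

Lemma quot_reprK : cancel quot_repr quot_proj.
Proof. exact: reprK. Qed.

Lemma quot_projP x y : quot_proj x = quot_proj y <-> I (x - y).
Proof.
have eI := Quotient.idealrBE ideal_zmod x y.
split=> [/eqP|Ixy]; first by rewrite -eI ideal_predE => /asboolP.
by apply/eqP; rewrite -[_ == _]eI ideal_predE; exact/asboolP.
Qed.

Lemma quot_proj_is_zmod_morphism : zmod_morphism quot_proj.
Proof. by move=> x y; exact: (raddfB (\pi_(Quotient.quot ideal_zmod))). Qed.

HB.instance Definition _ :=
  GRing.isZmodMorphism.Build R ring_quot quot_proj quot_proj_is_zmod_morphism.

Definition quot_mul (x y : ring_quot) : ring_quot :=
  quot_proj (quot_repr x * quot_repr y).

Lemma quot_projM x y : quot_proj (x * y) = quot_mul (quot_proj x) (quot_proj y).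
Proof.
apply/quot_projP; set x' := quot_repr _; set y' := quot_repr _.
have Ix : I (x - x') by apply/quot_projP; rewrite quot_reprK.
have Iy : I (y - y') by apply/quot_projP; rewrite quot_reprK.
have -> : x * y - x' * y' = (x - x') * y + x' * (y - y').
  by rewrite mulrBl mulrBr addrA subrK.
by apply: idealD; [exact: idealMr | exact: idealMl].
Qed.

Lemma quot_mulA : associative quot_mul.
Proof.
move=> x y z; rewrite -[x]quot_reprK -[y]quot_reprK -[z]quot_reprK.
by rewrite -!quot_projM mulrA.
Qed.

Lemma quot_mul1r : left_id (quot_proj 1) quot_mul.
Proof. by move=> x; rewrite -[x]quot_reprK -quot_projM mul1r. Qed.

Lemma quot_mulr1 : right_id (quot_proj 1) quot_mul.
Proof. by move=> x; rewrite -[x]quot_reprK -quot_projM mulr1. Qed.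

Lemma quot_mulDl : left_distributive quot_mul +%R.
Proof.
move=> x y z; rewrite -[x]quot_reprK -[y]quot_reprK -[z]quot_reprK.
by rewrite -raddfD -!quot_projM mulrDl raddfD.
Qed.

Lemma quot_mulDr : right_distributive quot_mul +%R.
Proof.
move=> x y z; rewrite -[x]quot_reprK -[y]quot_reprK -[z]quot_reprK.
by rewrite -raddfD -!quot_projM mulrDr raddfD.
Qed.

HB.instance Definition _ := GRing.Zmodule_isPzRing.Build ring_quot
  quot_mulA quot_mul1r quot_mulr1 quot_mulDl quot_mulDr.

Lemma quot_proj_is_monoid_morphism : monoid_morphism quot_proj.
Proof. by split=> [|x y]; [|exact: quot_projM]. Qed.

HB.instance Definition _ := GRing.isMonoidMorphism.Build R ring_quot quot_proj
  quot_proj_is_monoid_morphism.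

End RingQuotient.

Section IdealGeneratedBy.
Variables (R : pzRingType) (S : set R).

Lemma smallest_two_sided_ideal :
  two_sided_ideal (smallest (@two_sided_ideal R) S).
Proof.
split=> [J [[] //]|x y xS yS J [Jid SJ]|a x b xS J [Jid SJ]].
  by case: (Jid) => _ JD _; exact: JD (xS J (conj Jid SJ)) (yS J (conj Jid SJ)).
by case: (Jid) => _ _ JM; exact: JM (xS J (conj Jid SJ)).
Qed.

Definition ideal_gen : ideal R := Ideal smallest_two_sided_ideal.

End IdealGeneratedBy.

(* Noncommutative primes: tested on two-sided ideals, not on elements. *)
Definition prime_ideal (R : pzRingType) (P : ideal R) : Prop :=
  [/\ ideal_set P <> [set: R]
    & forall I J : ideal R, (forall x y, I x -> J y -> P (x * y)) ->
        I `<=` P \/ J `<=` P].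

Definition normal_elt (R : pzRingType) (z : R) : Prop :=
  [set z * r | r in [set: R]] = [set r * z | r in [set: R]].

Definition normally_separated (R : pzRingType) : Prop :=
  forall P Q : ideal R, prime_ideal P -> prime_ideal Q -> P `<` Q ->
    exists z : R, [/\ Q z, ~ P z & normal_elt (quot_proj P z)].

(* The free associative algebra k<x_1, ..., x_n, y_1, ..., y_n>: the monoid
   algebra of the free (noncommutative) monoid on two copies of 'I_n. *)
Section FreeAlgebra.
Variables (k : fieldType) (n : nat).

Definition free_alg : Type := {malg k[{fmonom ('I_n + 'I_n)%type}]}.

HB.instance Definition _ := GRing.Lalgebra.on free_alg.

Lemma free_alg_scalerAr (c : k) (u v : free_alg) : c *: (u * v) = u * (c *: v).
Proof.
apply/malgP => m; rewrite mcoeffZ.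
rewrite (mcoeffMlw _ (fsubset_refl (msupp u)) (fsubset_refl (msupp v))).
rewrite (mcoeffMlw _ (fsubset_refl (msupp u)) (msuppZ_le c v)).
rewrite mulr_sumr; apply: eq_bigr => m1 _; rewrite mulr_sumr.
by apply: eq_bigr => m2 _; rewrite mcoeffZ mulrnAr mulrCA.
Qed.

HB.instance Definition _ :=
  GRing.Lalgebra_isAlgebra.Build k free_alg free_alg_scalerAr.

Definition free_x (i : 'I_n) : free_alg := << fmu (inl i) >>.
Definition free_y (i : 'I_n) : free_alg := << fmu (inr i) >>.

End FreeAlgebra.

Section Kn.
Variables (k : fieldType) (n : nat) (p q : 'I_n -> k) (gamma : 'M[k]_n).

Local Notation x := (@free_x k n).
Local Notation y := (@free_y k n).

(* Each relation lhs = rhs is encoded as the element lhs - rhs. *)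
Inductive Kn_rel : set (free_alg k n) :=
| Kn_rel_yy (i j : 'I_n) :
    Kn_rel (y i * y j - gamma i j *: (y j * y i))
| Kn_rel_xy_lt (i j : 'I_n) : (i < j)%N ->
    Kn_rel (x i * y j - (p j * gamma j i) *: (y j * x i))
| Kn_rel_xy_gt (i j : 'I_n) : (j < i)%N ->
    Kn_rel (x i * y j - (q j * gamma j i) *: (y j * x i))
| Kn_rel_xx (i j : 'I_n) : (i < j)%N ->
    Kn_rel (x i * x j - (q i * (p j)^-1 * gamma i j) *: (x j * x i))
| Kn_rel_xy (i : 'I_n) :
    Kn_rel (x i * y i - (q i *: (y i * x i)
      + \sum_(l < n | (l < i)%N) (q l - p l) *: (y l * x l))).

Definition Kn_ideal : ideal (free_alg k n) := ideal_gen Kn_rel.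

Definition Kn : Type := ring_quot Kn_ideal.

HB.instance Definition _ := GRing.PzRing.on Kn.

(* The augmentation of the free algebra kills all relations, hence 1 <> 0. *)
Lemma Kn_ideal_augmentation (u : free_alg k n) :
  Kn_ideal u -> mcoeff (mone : {fmonom ('I_n + 'I_n)%type}) u = 0.
Proof.
pose J : set (free_alg k n) :=
  fun w => mcoeff (mone : {fmonom ('I_n + 'I_n)%type}) w = 0.
have JD v w : J v -> J w -> J (v + w).
  by move=> Jv Jw; rewrite /J raddfD /= Jv Jw addr0.
have JN v : J v -> J (- v) by move=> Jv; rewrite /J raddfN /= Jv oppr0.
have JM v w : J v -> J (v * w) by move=> Jv; rewrite /J rmorphM /= Jv mul0r.
have JZ c v : J v -> J (c *: v) by move=> Jv; rewrite /J mcoeffZ Jv mulr0.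
have J0 : J 0 by exact: raddf0.
have Jx i : J (x i) by rewrite /J mcoeffU1 fmuE /mone /= fmoneE.
have Jy i : J (y i) by rewrite /J mcoeffU1 fmuE /mone /= fmoneE.
move=> /(_ J); apply; split=> [|w].
  split; [exact: J0 | exact: JD | move=> a v b Jv; apply: (JM)].
  by rewrite /J rmorphM /= Jv mulr0.
case=> [i j|i j _|i j _|i j _|i].
- exact: JD (JM _ _ (Jy i)) (JN _ (JZ _ _ (JM _ _ (Jy j)))).
- exact: JD (JM _ _ (Jx i)) (JN _ (JZ _ _ (JM _ _ (Jy j)))).
- exact: JD (JM _ _ (Jx i)) (JN _ (JZ _ _ (JM _ _ (Jy j)))).
- exact: JD (JM _ _ (Jx i)) (JN _ (JZ _ _ (JM _ _ (Jx j)))).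
have JS : J (\sum_(l < n | (l < i)%N) (q l - p l) *: (y l * x l)).
  apply: (big_ind J J0 JD) => l _; exact: JZ _ _ (JM _ _ (Jy l)).
exact: JD (JM _ _ (Jx i)) (JN _ (JD _ _ (JZ _ _ (JM _ _ (Jy i))) JS)).
Qed.

Lemma Kn_oner_neq0 : (1 : Kn) != 0.
Proof.
apply/eqP => e10.
have /quot_projP : quot_proj Kn_ideal 1 = quot_proj Kn_ideal 0.
  by rewrite raddf0; exact: e10.
rewrite subr0 => /Kn_ideal_augmentation.
by move/eqP; rewrite mcoeff1 eqxx oner_eq0.
Qed.

HB.instance Definition _ := GRing.PzSemiRing_isNonZero.Build Kn Kn_oner_neq0.

Definition Kn_scale (c : k) (u : Kn) : Kn :=
  quot_proj Kn_ideal (c *: quot_repr u).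

Lemma Kn_scaleE (c : k) (u : free_alg k n) :
  Kn_scale c (quot_proj Kn_ideal u) = quot_proj Kn_ideal (c *: u).
Proof.
apply/quot_projP; rewrite -scalerBr -mulr_algl; apply: idealMl.
by apply/quot_projP; rewrite quot_reprK.
Qed.

Lemma Kn_scaleA c d u : Kn_scale c (Kn_scale d u) = Kn_scale (c * d) u.
Proof. by rewrite -[u]quot_reprK !Kn_scaleE scalerA. Qed.

Lemma Kn_scale1 : left_id 1 Kn_scale.
Proof. by move=> u; rewrite -[u]quot_reprK Kn_scaleE scale1r. Qed.

Lemma Kn_scaleDr : right_distributive Kn_scale +%R.
Proof.
move=> c u v; rewrite -[u]quot_reprK -[v]quot_reprK.
by rewrite -[_ + _]raddfD !Kn_scaleE scalerDr raddfD.
Qed.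

Lemma Kn_scaleDl u : {morph Kn_scale^~ u : c d / c + d}.
Proof. by move=> c d; rewrite -[u]quot_reprK !Kn_scaleE scalerDl raddfD. Qed.

HB.instance Definition _ := GRing.Zmodule_isLmodule.Build k Kn
  Kn_scaleA Kn_scale1 Kn_scaleDr Kn_scaleDl.

Lemma Kn_scalerAl (c : k) (u v : Kn) : c *: (u * v) = c *: u * v.
Proof.
have ZE w : c *: (quot_proj Kn_ideal w : Kn) = quot_proj Kn_ideal (c *: w).
  exact: Kn_scaleE.
rewrite -[u]quot_reprK -[v]quot_reprK.
by rewrite -[_ * _]rmorphM !ZE -[RHS]rmorphM scalerAl.
Qed.

HB.instance Definition _ := GRing.Lmodule_isLalgebra.Build k Kn Kn_scalerAl.

Lemma Kn_scalerAr (c : k) (u v : Kn) : c *: (u * v) = u * (c *: v).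
Proof.
have ZE w : c *: (quot_proj Kn_ideal w : Kn) = quot_proj Kn_ideal (c *: w).
  exact: Kn_scaleE.
rewrite -[u]quot_reprK -[v]quot_reprK.
by rewrite -[_ * _]rmorphM !ZE -[RHS]rmorphM scalerAr.
Qed.

HB.instance Definition _ := GRing.Lalgebra_isAlgebra.Build k Kn Kn_scalerAr.

End Kn.

(* Main.v *)
Require Import Defs.
From mathcomp Require Import all_boot all_algebra.
From mathcomp.multinomials Require Import monalg.
From mathcomp Require Import boolp classical_sets.
From mathcomp Require Import ring.

(** Write [Omega m] for the sum of [(q_l - p_l) y_l x_l] over [l < m]. The
    relations say that [x_i y_i] is both [q_i y_i x_i + Omega i] and [p_i y_i
    x_i + Omega (i+1)], and each [Omega m] commutes with every generator up to
    a nonzero scalar. For an ideal [P], call an element [P]-eigen if it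
    commutes modulo [P] with every generator up to a nonzero scalar; such an
    element is normal modulo [P], so the task is to find a [P]-eigen element in
    [Q] and not in [P]. Suppose that there is none.

    If [Omega i] or [Omega (i+1)] lies in [P], then [x_i] and [y_i] are
    [P]-eigen. For the other indices, called generic, [x_i] and [y_i] are far
    from normal, but they are still regular modulo [P] and modulo [Q]: the
    powers of [y_i] are an Ore set, no power lies in the prime ideal because
    [p_i / q_i] is not a root of unity, and the elements killed by some power
    form a two-sided ideal that is killed by a single power, since the algebra
    is left noetherian. Noetherianity is Hilbert's basis theorem for adjoining
    one element that commutes with the smaller ring up to lower terms.

    Take [z] in [Q] and not in [P]. Multiplying by enough generic [y_i] absorbs
    every generic [x_i], because [x_i y_i] is a combination of the [Omega]'s.
    The product is still in [Q] and not in [P], and modulo [P] it is a sum of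
    terms [v * w], with [v] a [P]-eigen element and [w] a word in the generic
    [y_i]. The rest is the argument that describes the ideals of a quantum
    torus: in a sum with as few terms as possible, all terms commute with a
    given [Omega] by the same scalar, since otherwise a combination of [Omega *
    z] and [z * Omega] is shorter. Comparing the scalars of [Omega i] and
    [Omega (i+1)] gives [(q_i / p_i) ^ d], where [d] is the degree of [w] in
    [y_i]; this determines [d]. Hence all the words [w] agree up to order and
    can be cancelled, leaving a sum of [P]-eigen elements in [Q] and not in
    [P]. A shortest such sum commutes with each generator by a single scalar,
    so the sum itself is [P]-eigen, a contradiction. *)

Set Implicit Arguments.
Unset Strict Implicit.
Unset Printing Implicit Defensive.

Import GRing.Theory.
Local Open Scope ring_scope.

(** * Hilbert's basis theorem for an almost normalizing element *)

Section Noetherian.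
Variable A : pzRingType.
Implicit Types (R I : A -> Prop) (t a b r s : A).

Definition subring R :=
  [/\ R 1, forall a b, R a -> R b -> R (a - b)
    & forall a b, R a -> R b -> R (a * b)].

Definition left_ideal R I :=
  [/\ forall a, I a -> R a, I 0, forall a b, I a -> I b -> I (a - b)
    & forall r a, R r -> I a -> I (r * a)].

(** The ascending chain condition, not finite generation: the proof of the
    basis theorem and the use made of it both deal with explicit chains. *)
Definition noetherian R := forall I : nat -> A -> Prop,
  (forall m, left_ideal R (I m)) ->
  (forall m a, I m a -> I m.+1 a) ->
  exists N, forall m a, I m a -> I N a.

Lemma subring0 R : subring R -> R 0.
Proof. by case=> R1 RB _; rewrite -(subrr 1); apply: RB. Qed.

Lemma subringN R a : subring R -> R a -> R (- a).
Proof.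
move=> hR Ra; rewrite -sub0r; case: (hR) => _ RB _.
exact: RB (subring0 hR) Ra.
Qed.

Lemma subringD R a b : subring R -> R a -> R b -> R (a + b).
Proof.
move=> hR Ra Rb; rewrite -[b]opprK; case: (hR) => _ RB _; apply: RB => //.
exact: subringN.
Qed.

Lemma left_idealD R I a b : left_ideal R I -> I a -> I b -> I (a + b).
Proof.
case=> _ I0 IB _ Ia Ib; rewrite -[b]opprK; apply: (IB) => //.
by rewrite -sub0r; apply: IB.
Qed.

Lemma chain_le (I : nat -> A -> Prop) m m' a :
  (forall m a, I m a -> I m.+1 a) -> (m <= m')%N -> I m a -> I m' a.
Proof.
move=> hI /subnK <-; elim: (m' - m)%N => // d IH Ia.
by rewrite addSn; apply/hI/IH.
Qed.

(** Right polynomials in [t] of degree less than [d]. Coefficients stand on the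
    right so that the leading coefficients of a left ideal form a left ideal.
    *)
Fixpoint polys R t d : A -> Prop :=
  if d is e.+1 then
    fun a => exists r b, [/\ R r, polys R t e b & a = t ^+ e * r + b]
  else fun a => a = 0.

Definition adjoin R t : A -> Prop := fun a => exists d, polys R t d a.

Section Adjoin.
Variables (R : A -> Prop) (t : A).
Hypothesis hR : subring R.
Hypothesis push : forall r, R r -> exists r1 r2,
  [/\ R r1, R r2 & r * t = t * r1 + r2].
Hypothesis pull : forall r, R r -> exists r1 r2,
  [/\ R r1, R r2 & t * r = r1 * t + r2].

Let R0 := subring0 hR.
Let RB a b : R a -> R b -> R (a - b). Proof. by case: hR => _ h _; apply: h. Qed.
Let RM a b : R a -> R b -> R (a * b). Proof. by case: hR => _ _; apply. Qed.
Let P := polys R t.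

Lemma polys0 d : P d 0.
Proof.
elim: d => // d IH; exists 0, 0; split=> //; by rewrite mulr0 addr0.
Qed.

Lemma polysB d a b : P d a -> P d b -> P d (a - b).
Proof.
elim: d a b => [|d IH] a b /=; first by move=> -> ->; rewrite subrr.
case=> r [a' [Rr Pa ->]] [s [b' [Rs Pb ->]]].
exists (r - s), (a' - b'); split; [exact: RB|exact: IH|].
by rewrite mulrBr opprD addrACA.
Qed.

Lemma polysN d a : P d a -> P d (- a).
Proof. by move=> Pa; rewrite -sub0r; apply: polysB Pa; apply: polys0. Qed.

Lemma polysD d a b : P d a -> P d b -> P d (a + b).
Proof. by move=> Pa Pb; rewrite -[b]opprK; apply: polysB => //; apply: polysN. Qed.

Lemma polysS d a : P d a -> P d.+1 a.
Proof. by exists 0, a; split=> //; rewrite mulr0 add0r. Qed.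

Lemma polysW d e a : (d <= e)%N -> P d a -> P e a.
Proof. by apply: chain_le; apply: polysS. Qed.

Lemma polys_top d r : R r -> P d.+1 (t ^+ d * r).
Proof. by exists r, 0; split=> //; [exact: polys0|rewrite addr0]. Qed.

Lemma polysMr d a r : P d a -> R r -> P d (a * r).
Proof.
elim: d a => [|d IH] a /=; first by move=> -> _; rewrite mul0r.
case=> s [b [Rs Pb ->]] Rr; exists (s * r), (b * r); split; first exact: RM.
  exact: IH.
by rewrite mulrDl mulrA.
Qed.

Lemma polysMt d a : P d a -> P d.+1 (a * t).
Proof.
elim: d a => [|d IH] a; first by move=> /= ->; rewrite mul0r; apply: (polys0 1).
case=> r [b [Rr Pb ->]]; have [r1 [r2 [Rr1 Rr2 e]]] := push Rr.
exists r1, (t ^+ d * r2 + b * t); split=> //.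
  by apply: (@polysD d.+1); [exact: polys_top|exact: IH].
by rewrite mulrDl -mulrA e mulrDr mulrA -exprSr addrA.
Qed.

Lemma polys_tM d a : P d a -> P d.+1 (t * a).
Proof.
elim: d a => [|d IH] a; first by move=> /= ->; rewrite mulr0; apply: (polys0 1).
case=> r [b [Rr Pb ->]]; exists r, (t * b); split=> //; first exact: IH.
by rewrite mulrDr mulrA -exprS.
Qed.

Lemma polys_texpM e d a : P d a -> P (e + d) (t ^+ e * a).
Proof.
elim: e => [|e IH] Pa; first by rewrite mul1r.
by rewrite exprS -mulrA; apply/polys_tM/IH.
Qed.

(** A coefficient moves across a power of [t] at the cost of terms of lower
    degree. *)
Lemma push_exp d r : R r -> exists r', R r' /\ P d (r * t ^+ d - t ^+ d * r').
Proof.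
elim: d r => [|d IH] r Rr.
  by exists r; split=> //; rewrite expr0 mulr1 mul1r subrr; apply: polys0.
have [s [Rs Ps]] := IH r Rr; have [r1 [r2 [Rr1 Rr2 e]]] := push Rs.
exists r1; split=> //.
have -> : r * t ^+ d.+1 - t ^+ d.+1 * r1
  = (r * t ^+ d - t ^+ d * s) * t + t ^+ d * r2.
  by rewrite !exprSr mulrBl -!mulrA e mulrDr opprD !mulrA addrA subrK.
by apply: polysD; [exact: polysMt|exact: polys_top].
Qed.

(** The surjective counterpart: every coefficient to the right of [t ^+ d]
    comes from one to the left. It makes leading coefficients stable under left
    multiplication. *)
Lemma pull_exp d r : R r -> exists r', R r' /\ P d (r' * t ^+ d - t ^+ d * r).
Proof.
elim: d r => [|d IH] r Rr.
  by exists r; split=> //; rewrite expr0 mulr1 mul1r subrr; apply: polys0.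
have [r1 [r2 [Rr1 Rr2 e]]] := pull Rr; have [s [Rs Ps]] := IH r1 Rr1.
exists s; split=> //.
have -> : s * t ^+ d.+1 - t ^+ d.+1 * r
  = (s * t ^+ d - t ^+ d * r1) * t - t ^+ d * r2.
  by rewrite !exprSr mulrBl -!mulrA e mulrDr opprD !mulrA addrA.
by apply: polysB; [exact: polysMt|exact: polys_top].
Qed.

Lemma polysMl d r a : R r -> P d a -> P d (r * a).
Proof.
move=> Rr; elim: d a => [|d IH] a /=; first by move=> ->; rewrite mulr0.
case=> s [b [Rs Pb ->]]; have [r' [Rr' Pr]] := push_exp d Rr.
exists (r' * s), ((r * t ^+ d - t ^+ d * r') * s + r * b); split.
- exact: RM.
- by apply: polysD; [exact: polysMr|exact: IH].
by rewrite mulrDr mulrBl !mulrA addrA subrKC.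
Qed.

Lemma adjoin_subring : subring (adjoin R t).
Proof.
have AD a b : adjoin R t a -> adjoin R t b -> adjoin R t (a - b).
  case=> d Pa [e Pb]; exists (maxn d e).
  apply: polysB; first by apply: polysW Pa; apply: leq_maxl.
  by apply: polysW Pb; apply: leq_maxr.
split=> //.
  by exists 1%N, 1, 0; split=> //; [case: hR|rewrite mulr1 addr0].
move=> a b [d]; elim: d a => [|d IH] a /=.
  by move=> -> _; rewrite mul0r; exists 0%N.
case=> r [a' [Rr Pa ->]] Ab; rewrite mulrDl -[a' * b]opprK.
apply: (AD); last first.
  by rewrite -sub0r; apply: (AD); [exists 0%N|exact: IH].
case: Ab => e Pb; exists (d + e)%N.
by rewrite -mulrA; apply/polys_texpM/polysMl.
Qed.

Lemma sub_adjoin r : R r -> adjoin R t r.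
Proof. by move=> Rr; exists 1%N, r, 0; split=> //; rewrite mul1r addr0. Qed.

Lemma mem_adjoin : adjoin R t t.
Proof.
exists 2%N, 1, 0; split=> //; [by case: hR|exact: (polys0 1)|].
by rewrite mulr1 addr0.
Qed.

Definition lead I d : A -> Prop :=
  fun r => R r /\ exists b, P d b /\ I (t ^+ d * r + b).

Lemma lead_left_ideal I d : left_ideal (adjoin R t) I -> left_ideal R (lead I d).
Proof.
case=> IS I0 IB IM; split.
- by move=> a [].
- by split=> //; exists 0; split; [exact: polys0|rewrite mulr0 addr0].
- move=> a b [Ra [a' [Pa Ia]]] [Rb [b' [Pb Ib]]]; split; first exact: RB.
  exists (a' - b'); split; first exact: polysB.
  by rewrite mulrBr addrACA -opprD; apply: IB.
move=> r a Rr [Ra [a' [Pa Ia]]]; split; first exact: RM.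
have [s [Rs Ps]] := pull_exp d Rr.
exists ((s * t ^+ d - t ^+ d * r) * a + s * a'); split.
  by apply: polysD; [exact: polysMr|exact: polysMl].
have -> : t ^+ d * (r * a) + ((s * t ^+ d - t ^+ d * r) * a + s * a')
  = s * (t ^+ d * a + a').
  by rewrite mulrDr mulrBl !mulrA addrA subrKC.
by apply: IM => //; apply: sub_adjoin.
Qed.

Lemma leadS I d r : left_ideal (adjoin R t) I -> lead I d r -> lead I d.+1 r.
Proof.
case=> _ _ _ IM [Rr [b [Pb Ib]]]; split=> //; exists (t * b); split.
  exact: polys_tM.
by rewrite exprS -mulrA -mulrDr; apply: IM => //; apply: mem_adjoin.
Qed.

(** A left ideal is recovered from its leading coefficients, by cancelling the
    top term repeatedly. *)
Lemma lead_dominates (I J : A -> Prop) :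
  left_ideal (adjoin R t) I -> left_ideal (adjoin R t) J ->
  (forall a, I a -> J a) -> (forall d r, lead J d r -> lead I d r) ->
  forall a, J a -> I a.
Proof.
move=> hI hJ IJ JI a Ja; have [JS _ _ _] := hJ; case: (JS a Ja) => d Pa.
elim: d a Ja Pa => [|d IH] a Ja /=.
  by move=> ->; case: hI.
case=> r [b [Rr Pb ea]].
have [_ [c [Pc Ic]]] : lead I d r.
  by apply: JI; split=> //; exists b; rewrite -ea.
have -> : a = (t ^+ d * r + c) + (b - c) by rewrite ea -addrA (addrC b) addNKr.
apply: (left_idealD hI Ic); apply: IH; last exact: polysB.
have [_ _ JB _] := hJ.
have -> : b - c = a - (t ^+ d * r + c) by rewrite ea opprD addrACA subrr add0r.
by apply: JB => //; apply: IJ.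
Qed.

(** The leading coefficients [lead (I m) d] grow in both [m] and [d]. The
    diagonal stabilizes at some [N], which settles all degrees [d >= N] at
    once; only the finitely many chains with [d < N] remain. *)
Theorem adjoin_noetherian : noetherian R -> noetherian (adjoin R t).
Proof.
move=> nR I hI mI.
have mL d m r : lead (I m) d r -> lead (I m.+1) d r.
  by case=> Rr [b [Pb Ib]]; split=> //; exists b; split=> //; apply: mI.
have leW d m m' r : (m <= m')%N -> lead (I m) d r -> lead (I m') d r.
  by apply: (@chain_le (fun m => lead (I m) d)); apply: mL.
have leD m d d' r : (d <= d')%N -> lead (I m) d r -> lead (I m) d' r.
  by apply: chain_le => e s; apply: leadS.
have [N hN] : exists N, forall m r, lead (I m) m r -> lead (I N) N r.
  apply: (nR (fun m => lead (I m) m)) => [m|m r]; first exact: lead_left_ideal.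
  by move=> /mL; apply: leadS.
have [M hM] : exists M, forall d m r, (d < N)%N ->
    lead (I m) d r -> lead (I M) d r.
  elim: {hN} N => [|N [M hM]]; first by exists 0%N.
  have [K hK] := nR (fun m => lead (I m) N)
    (fun m => lead_left_ideal N (hI m)) (mL N).
  exists (maxn M K) => d m r; rewrite ltnS leq_eqVlt => /orP [/eqP ->|dN].
    by move=> /hK; apply: leW; apply: leq_maxr.
  by move=> /(hM _ _ _ dN); apply: leW; apply: leq_maxl.
exists (maxn M N) => m a Ia.
have ha : I (maxn m (maxn M N)) a.
  by apply: chain_le Ia => //; apply: leq_maxl.
move: a ha {Ia}; apply: lead_dominates => // [a|d r].
  by apply: chain_le => //; apply: leq_maxr.
have [dN|Nd] := ltnP d N.
  by move=> /(hM _ _ _ dN); apply: leW; apply: leq_maxl.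
set m' := maxn m _ => hr.
(* Both indices are raised to a common value, which lies on the diagonal. *)
have {}hr : lead (I N) N r.
  apply: (hN (maxn m' d)); apply: leD (leq_maxr m' d) _.
  by apply: leW hr; apply: leq_maxl.
by apply: leW (leq_maxr M N) _; apply: leD Nd hr.
Qed.

End Adjoin.
End Noetherian.

(** * Algebras obtained by adjoining elements one at a time *)

Section Towers.
Variables (k : fieldType) (A : algType k).
Implicit Types (t a b r s : A) (l : seq A).

Fixpoint tower_ring l : A -> Prop :=
  if l is t :: l' then adjoin (tower_ring l') t
  else fun a => exists c : k, a = c%:A.

(** Almost normalization is only asked of the generators: it passes to products
    and differences, hence to the whole ring that they generate. *)
Fixpoint is_tower l : Prop :=
  if l is t :: l' then
    is_tower l' /\ forall s, s \in l' ->
      (exists r1 r2, [/\ tower_ring l' r1, tower_ring l' r2 & s * t = t * r1 + r2])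
      /\ (exists r1 r2, [/\ tower_ring l' r1, tower_ring l' r2 & t * s = r1 * t + r2])
  else True.

Lemma scalars_subring : subring (tower_ring [::]).
Proof.
split=> [|_ _ [c ->] [d ->]|_ _ [c ->] [d ->]].
- by exists 1; rewrite scale1r.
- by exists (c - d); rewrite scalerBl.
by exists (c * d); rewrite -scalerAl mul1r scalerA.
Qed.

Lemma scalars_noetherian : noetherian (tower_ring [::]).
Proof.
move=> I hI mI.
have [[m [a [Ia a0]]]|hn] := pselect (exists m a, I m a /\ a <> 0); last first.
  exists 0%N => m a Ia; have [_ I0 _ _] := hI 0%N.
  by case: (pselect (a = 0)) => [->//|na]; case: hn; exists m, a.
exists m => m' b Ib; have [IS _ _ IM] := hI m.
have [c ea] := IS a Ia; have [IS' _ _ _] := hI m'; have [d eb] := IS' b Ib.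
have c0 : c != 0 by apply/eqP => c0; apply: a0; rewrite ea c0 scale0r.
have -> : b = (d / c)%:A * a.
  by rewrite eb ea -scalerAl mul1r scalerA divfK.
by apply: IM => //; exists (d / c).
Qed.

Lemma tower_ring_min l (C : A -> Prop) :
  (forall c : k, C c%:A) -> (forall a b, C a -> C b -> C (a - b)) ->
  (forall a b, C a -> C b -> C (a * b)) -> (forall s, s \in l -> C s) ->
  forall a, tower_ring l a -> C a.
Proof.
move=> C1 CB CM; elim: l => [|t l IH] Cl a /=; first by case=> c ->.
have Ct : C t by apply: Cl; rewrite mem_head.
have {}IH := IH (fun s hs => Cl s (mem_behead (s := t :: l) hs)).
have C0 : C 0 by rewrite -(scale0r 1).
case=> d; elim: d a => [|d IHd] a /=; first by move=> ->.
case=> r [b [Rr Pb ->]]; rewrite -[b]opprK; apply: (CB).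
  apply: (CM); last exact: IH.
  elim: d {IHd Pb} => [|d IHd]; first by rewrite expr0 -(scale1r 1).
  by rewrite exprS; apply: (CM).
by rewrite -sub0r; apply: (CB) => //; apply: (IHd).
Qed.

Lemma is_towerP l : is_tower l ->
  [/\ subring (tower_ring l), noetherian (tower_ring l),
      forall c : k, tower_ring l c%:A & forall s, s \in l -> tower_ring l s].
Proof.
elim: l => [|t l IH] /=.
  move=> _; split=> //; first exact: scalars_subring.
  - exact: scalars_noetherian.
  by move=> c; exists c.
case=> /IH [Rs Rn Rc Rl] ht.
have [R1 RB RM] := Rs; have R0 := subring0 Rs.
have push r : tower_ring l r -> exists r1 r2,
    [/\ tower_ring l r1, tower_ring l r2 & r * t = t * r1 + r2].
  move: r; suff: forall r, tower_ring l r -> tower_ring l r /\ exists r1 r2,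
    [/\ tower_ring l r1, tower_ring l r2 & r * t = t * r1 + r2].
    by move=> h r /h [].
  apply: tower_ring_min.
  - move=> c; split=> //; exists c%:A, 0; split=> //.
    by rewrite addr0 -scalerAl -scalerAr mul1r mulr1.
  - move=> a b [Ra [a1 [a2 [Ra1 Ra2 ea]]]] [Rb [b1 [b2 [Rb1 Rb2 eb]]]].
    split; first exact: RB.
    exists (a1 - b1), (a2 - b2); split; [exact: RB|exact: RB|].
    by rewrite mulrBl mulrBr ea eb opprD addrACA.
  - move=> a b [Ra [a1 [a2 [Ra1 Ra2 ea]]]] [Rb [b1 [b2 [Rb1 Rb2 eb]]]].
    split; first exact: RM.
    exists (a1 * b1), (a2 * b1 + a * b2); split; first exact: RM.
      by apply: subringD => //; exact: RM.
    by rewrite -mulrA eb mulrDr mulrA ea mulrDl mulrA addrA.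
  by move=> s ls; split; [exact: Rl|case: (ht s ls)].
have pull r : tower_ring l r -> exists r1 r2,
    [/\ tower_ring l r1, tower_ring l r2 & t * r = r1 * t + r2].
  move: r; suff: forall r, tower_ring l r -> tower_ring l r /\ exists r1 r2,
    [/\ tower_ring l r1, tower_ring l r2 & t * r = r1 * t + r2].
    by move=> h r /h [].
  apply: tower_ring_min.
  - move=> c; split=> //; exists c%:A, 0; split=> //.
    by rewrite addr0 -scalerAl -scalerAr mul1r mulr1.
  - move=> a b [Ra [a1 [a2 [Ra1 Ra2 ea]]]] [Rb [b1 [b2 [Rb1 Rb2 eb]]]].
    split; first exact: RB.
    exists (a1 - b1), (a2 - b2); split; [exact: RB|exact: RB|].
    by rewrite mulrBr mulrBl ea eb opprD addrACA.
  - move=> a b [Ra [a1 [a2 [Ra1 Ra2 ea]]]] [Rb [b1 [b2 [Rb1 Rb2 eb]]]].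
    split; first exact: RM.
    exists (a1 * b1), (a1 * b2 + a2 * b); split; first exact: RM.
      by apply: subringD => //; exact: RM.
    by rewrite mulrA ea mulrDl -mulrA eb mulrDr mulrA addrA.
  by move=> s ls; split; [exact: Rl|case: (ht s ls)].
split.
- exact: adjoin_subring.
- exact: adjoin_noetherian.
- by move=> c; apply: sub_adjoin.
move=> s; rewrite inE => /orP [/eqP ->|ls]; first exact: mem_adjoin.
by apply/sub_adjoin/Rl.
Qed.

End Towers.

(** * Prime ideals *)

Section PrimeIdeals.
Variables (R : pzRingType) (P : ideal R).

Lemma idealB a b : P a -> P b -> P (a - b).
Proof. by move=> Pa Pb; apply: idealD => //; apply: idealN. Qed.

Lemma ideal_sub a b : P (a - b) -> P a <-> P b.
Proof.
move=> Pab; split=> [Pa|Pb].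
  by rewrite -(subKr a b); apply: idealB.
by rewrite -(subrK b a); apply: idealD.
Qed.

Lemma prime_neq1 : prime_ideal P -> ~ P 1.
Proof.
case=> nT _ P1; apply: nT; apply/seteqP; split=> // a _.
by rewrite -[a]mulr1; apply: idealMl.
Qed.

(** The elements [u] with [u r b] in [P] for all [r] form a two-sided ideal,
    and so do the elements annihilated on the left by that ideal modulo [P]. *)
Lemma prime_elt a b : prime_ideal P -> (forall r, P (a * r * b)) -> P a \/ P b.
Proof.
case=> _ pP hab.
have hI : two_sided_ideal (fun u : R => forall r, P (u * r * b)).
  split=> [r|u v hu hv r|s u v hu r]; first by rewrite !mul0r; apply: ideal0.
    by rewrite !mulrDl; apply: idealD.
  by rewrite -!mulrA; apply: idealMl; rewrite !mulrA -(mulrA u).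
pose I := Ideal hI.
have hJ : two_sided_ideal (fun v : R => forall u, I u -> forall r, P (u * r * v)).
  split=> [u _ r|v w hv hw u hu r|s v w hv u hu r].
  - by rewrite mulr0; apply: ideal0.
  - by rewrite mulrDr; apply: idealD; [apply: hv|apply: hw].
  by rewrite !mulrA; apply: Defs.idealMr; rewrite -(mulrA u); apply: hv.
case: (pP I (Ideal hJ)).
- by move=> u v hu hv; rewrite -[u]mulr1; apply: hv.
- by move=> /(_ a hab); left.
by move=> /(_ b (fun u hu r => hu r)); right.
Qed.

End PrimeIdeals.

(** * Commutation up to a scalar modulo an ideal *)

Section QCommutation.
Variables (k : fieldType) (A : algType k) (P : ideal A).
Implicit Types (a b u v w r : A) (c d : k).

Lemma idealZ c a : P a -> P (c *: a).
Proof. by move=> Pa; rewrite -[a]mul1r scalerAl; apply: idealMl. Qed.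

Definition qcomm c a b := P (a * b - c *: (b * a)).

Lemma qcomm_eq c a b : a * b = c *: (b * a) -> qcomm c a b.
Proof. by rewrite /qcomm => ->; rewrite subrr; apply: ideal0. Qed.

Lemma qcommMr c d a b b' :
  qcomm c a b -> qcomm d a b' -> qcomm (c * d) a (b * b').
Proof.
rewrite /qcomm => h h'.
have -> : a * (b * b') - (c * d) *: (b * b' * a)
  = (a * b - c *: (b * a)) * b' + c *: (b * (a * b' - d *: (b' * a))).
  by rewrite mulrBl mulrBr scalerBr -!scalerAr -!scalerAl scalerA !mulrA subrKA.
by apply: idealD; [apply: Defs.idealMr|apply/idealZ/idealMl].
Qed.

Lemma qcommMl c d a a' b :
  qcomm c a b -> qcomm d a' b -> qcomm (c * d) (a * a') b.
Proof.
rewrite /qcomm => h h'.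
have -> : a * a' * b - (c * d) *: (b * (a * a'))
  = a * (a' * b - d *: (b * a')) + d *: ((a * b - c *: (b * a)) * a').
  rewrite mulrBl mulrBr scalerBr -!scalerAr -!scalerAl scalerA !mulrA subrKA.
  by rewrite mulrC.
by apply: idealD; [apply: idealMl|apply/idealZ/Defs.idealMr].
Qed.

Lemma qcommDl c a a' b : qcomm c a b -> qcomm c a' b -> qcomm c (a + a') b.
Proof.
rewrite /qcomm => h h'.
by rewrite mulrDl mulrDr scalerDr opprD addrACA; apply: idealD.
Qed.

Lemma qcommDr c a b b' : qcomm c a b -> qcomm c a b' -> qcomm c a (b + b').
Proof.
rewrite /qcomm => h h'.
by rewrite mulrDl mulrDr scalerDr opprD addrACA; apply: idealD.
Qed.

Lemma qcommZl c d a b : qcomm c a b -> qcomm c (d *: a) b.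
Proof.
rewrite /qcomm -scalerAl -scalerAr scalerA mulrC -scalerA -scalerBr.
exact: idealZ.
Qed.

Lemma qcommZr c d a b : qcomm c a b -> qcomm c a (d *: b).
Proof.
rewrite /qcomm -scalerAl -scalerAr scalerA mulrC -scalerA -scalerBr.
exact: idealZ.
Qed.

Lemma qcomm_sum c a (s : seq A) :
  (forall u, u \in s -> qcomm c a u) -> qcomm c a (\sum_(u <- s) u).
Proof.
move=> h; rewrite big_seq; elim/big_rec: _ => [|u z us]; last exact/qcommDr/h.
by apply: qcomm_eq; rewrite mulr0 mul0r scaler0.
Qed.

Lemma qcommV c a b : c != 0 -> qcomm c a b -> qcomm c^-1 b a.
Proof.
rewrite /qcomm => c0 h.
have -> : b * a - c^-1 *: (a * b) = - c^-1 *: (a * b - c *: (b * a)).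
  by rewrite scaleNr scalerBr scalerA mulVf // scale1r opprB.
exact: idealZ.
Qed.

Lemma qcomm_uniq c d a b : qcomm c a b -> qcomm d a b -> ~ P (b * a) -> c = d.
Proof.
rewrite /qcomm => h h' nP; apply/eqP; rewrite -subr_eq0; apply/negPn/negP => cd.
apply: nP; rewrite -[b * a](scalerK cd); apply: idealZ.
have -> : (c - d) *: (b * a) = (a * b - d *: (b * a)) - (a * b - c *: (b * a)).
  by rewrite opprB [RHS]addrC subrKA scalerBl.
exact: idealB.
Qed.

End QCommutation.

(** * Normal elements and regular elements of a generated algebra *)

Section Generated.
Variables (k : fieldType) (A : algType k) (T : Type) (g : T -> A).
Implicit Types (P Q : ideal A) (a b u v w r : A) (c d : k).

(** As an induction principle: every element is reached from [1] by linear
    combinations and left multiplication by generators. *)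
Definition generates := forall S : A -> Prop,
  S 1 -> (forall a b, S a -> S b -> S (a + b)) ->
  (forall c a, S a -> S (c *: a)) -> (forall i a, S a -> S (g i * a)) ->
  forall a, S a.

Hypothesis gen : generates.

Definition eigen P u := forall i, exists2 c, c != 0 & qcomm P c (g i) u.

Lemma eigenM P u v : eigen P u -> eigen P v -> eigen P (u * v).
Proof.
move=> hu hv i; have [c c0 hc] := hu i; have [d d0 hd] := hv i.
by exists (c * d); [rewrite mulf_neq0|exact: qcommMr].
Qed.

Lemma eigenZ P d u : eigen P u -> eigen P (d *: u).
Proof. by move=> hu i; have [c c0 hc] := hu i; exists c => //; apply: qcommZr. Qed.

Lemma eigen1 P : eigen P 1.
Proof.
move=> i; exists 1; first exact: oner_neq0.
by apply: qcomm_eq; rewrite scale1r mulr1 mul1r.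
Qed.

Lemma eigen_subset P Q u : (forall a, P a -> Q a) -> eigen P u -> eigen Q u.
Proof. by move=> PQ hu i; have [c c0 hc] := hu i; exists c => //; apply: PQ. Qed.

Lemma eigen_swapl P u : eigen P u -> forall r, exists r', P (r * u - u * r').
Proof.
move=> hu; apply: gen.
- by exists 1; rewrite mul1r mulr1 subrr; apply: ideal0.
- move=> a b [a' ha] [b' hb]; exists (a' + b').
  by rewrite mulrDl mulrDr opprD addrACA; apply: idealD.
- move=> c a [a' ha]; exists (c *: a').
  by rewrite -scalerAl -scalerAr -scalerBr; apply: idealZ.
move=> i a [a' ha]; have [c c0 hc] := hu i; exists (c *: (g i * a')).
have -> : g i * a * u - u * (c *: (g i * a'))
  = g i * (a * u - u * a') + (g i * u - c *: (u * g i)) * a'.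
  by rewrite mulrBr mulrBl !mulrA subrKA -scalerAr -scalerAl !mulrA.
by apply: idealD; [apply: idealMl|apply: Defs.idealMr].
Qed.

Lemma eigen_swapr P u : eigen P u -> forall r, exists r', P (u * r - r' * u).
Proof.
move=> hu; apply: gen.
- by exists 1; rewrite mul1r mulr1 subrr; apply: ideal0.
- move=> a b [a' ha] [b' hb]; exists (a' + b').
  by rewrite mulrDl mulrDr opprD addrACA; apply: idealD.
- move=> c a [a' ha]; exists (c *: a').
  by rewrite -scalerAl -scalerAr -scalerBr; apply: idealZ.
move=> i a [a' ha]; have [c c0 hc] := hu i; exists (c^-1 *: (g i * a')).
have -> : u * (g i * a) - c^-1 *: (g i * a') * u
  = (u * g i - c^-1 *: (g i * u)) * a + c^-1 *: (g i * (u * a - a' * u)).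
  rewrite mulrBl mulrBr scalerBr -!scalerAl !mulrA subrKA.
  by [].
apply: idealD; [apply: Defs.idealMr|apply/idealZ/idealMl] => //.
exact: qcommV.
Qed.

(** A normal element outside a prime ideal is regular modulo it: [w r u] equals
    [w u r'] modulo [Q], so [w r u] is in [Q] for all [r]. *)
Lemma eigen_regular Q u w :
  prime_ideal Q -> eigen Q u -> ~ Q u -> Q (w * u) -> Q w.
Proof.
move=> pQ hu nQu Qwu.
have [r|//|/nQu] := @prime_elt _ Q w u pQ; last by [].
have [r' hr] := eigen_swapl hu r; have Qw := Defs.idealMr r' Qwu.
apply/(ideal_sub (b := w * u * r')) => //.
by rewrite -!mulrA -mulrBr; apply: idealMl.
Qed.

Lemma eigen_normal P u : eigen P u -> normal_elt (quot_proj P u).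
Proof.
move=> hu; apply/seteqP; split=> _ [r _ <-].
  have [r' hr] := eigen_swapr hu (quot_repr r).
  exists (quot_proj P r') => //; rewrite -[r]quot_reprK -!rmorphM.
  by apply/esym/quot_projP.
have [r' hr] := eigen_swapl hu (quot_repr r).
exists (quot_proj P r') => //; rewrite -[r]quot_reprK -!rmorphM.
by apply/esym/quot_projP.
Qed.

(** The elements [w] with [w * t ^+ m] in [Q] for some [m] form a left ideal,
    which noetherianity puts at a single level [N]; the Ore condition makes it
    stable on the right as well. Hence [w r t ^+ N] is in [Q] for every [r],
    and primeness applies, as [t ^+ N] is not in [Q]. *)
Lemma ore_regular Q t : noetherian (fun _ : A => True) -> prime_ideal Q ->
  (forall i m, exists r, g i * t ^+ m.+1 = t ^+ m * r) ->
  (forall m, ~ Q (t ^+ m)) -> forall w, Q (w * t) -> Q w.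
Proof.
move=> nA pQ ore tQ w Qwt.
pose I m w := Q (w * t ^+ m).
have IS m a : I m a -> I m.+1 a.
  by rewrite /I exprSr mulrA; apply: Defs.idealMr.
have [|N hN] := nA I _ IS.
  move=> m; split=> //; rewrite /I.
  - by rewrite mul0r; apply: ideal0.
  - by move=> a b Ia Ib; rewrite mulrBl; apply: idealB.
  by move=> r a _ Ia; rewrite -mulrA; apply: idealMl.
have oreA : forall a m, exists m' r, a * t ^+ m' = t ^+ m * r.
  apply: gen.
  - by move=> m; exists m, 1; rewrite mul1r mulr1.
  - move=> a b ha hb m; have [ma [ra ea]] := ha m; have [mb [rb eb]] := hb m.
    exists (ma + mb)%N, (ra * t ^+ mb + rb * t ^+ ma).
    rewrite mulrDl mulrDr {1}exprD mulrA ea addnC exprD mulrA eb.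
    by rewrite !mulrA.
  - move=> c a ha m; have [m' [r e]] := ha m; exists m', (c *: r).
    by rewrite -scalerAl -scalerAr e.
  move=> i a ha m; have [m' [r e]] := ha m.+1; have [r' e'] := ore i m.
  by exists m', (r' * r); rewrite -mulrA e mulrA e' mulrA.
have [r|//|/tQ] := @prime_elt _ Q w (t ^+ N) pQ; last by [].
have [m [r' e]] := oreA r 1%N.
by apply: (hN m); rewrite /I -mulrA e expr1 mulrA; apply: Defs.idealMr.
Qed.

(** The coefficient [c] is the sum of the [a ^+ e * b ^+ f] with [e + f = m];
    all that matters is that it is nonzero when [a ^+ m.+1] and [b ^+ m.+1]
    differ. *)
Lemma skew_power (s t o : A) (a b : k) :
  s * t = a *: (t * s) + o -> o * t = b *: (t * o) ->
  forall m, exists c, (a - b) * c = a ^+ m.+1 - b ^+ m.+1 /\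
    s * t ^+ m.+1 = a ^+ m.+1 *: (t ^+ m.+1 * s) + c *: (t ^+ m * o).
Proof.
move=> st ot; elim=> [|m [c [ec IH]]].
  by exists 1; rewrite mulr1 !expr1 expr0 mul1r scale1r st.
exists (a ^+ m.+1 + b * c); split.
  rewrite mulrDr (mulrCA _ b) ec mulrBr mulrBl -!exprS.
  by rewrite [RHS]/= addrA subrK.
rewrite exprSr mulrA IH mulrDl -!scalerAl -!mulrA st ot.
rewrite mulrDr scalerDr -!scalerAr !scalerA !mulrA -!exprSr -addrA scalerDl.
by rewrite (mulrC c).
Qed.

(** If [t ^+ m.+1] is in [Q], commuting [s] through it shows that [t ^+ m * o]
    is in [Q], and the normal element [o] cancels. So the exponent descends to
    [0]. *)
Lemma skew_powers_notin Q (s t o : A) (a b : k) :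
  s * t = a *: (t * s) + o -> o * t = b *: (t * o) ->
  (forall m, a ^+ m.+1 != b ^+ m.+1) -> prime_ideal Q -> eigen Q o -> ~ Q o ->
  forall m, ~ Q (t ^+ m).
Proof.
move=> st ot ab pQ ho nQo; elim=> [|m IH]; first exact: prime_neq1.
move=> Qt; apply: IH; have [c [ec e]] := skew_power st ot m.
have c0 : c != 0.
  by apply: contra_neq (ab m) => c0; apply/eqP; rewrite -subr_eq0 -ec c0 mulr0.
apply: (eigen_regular pQ ho nQo).
rewrite -[_ * o](scalerK c0); apply: idealZ.
have -> : c *: (t ^+ m * o) = s * t ^+ m.+1 - a ^+ m.+1 *: (t ^+ m.+1 * s).
  by rewrite e addrC addKr.
by apply: idealB; [apply: idealMl|apply/idealZ/Defs.idealMr].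
Qed.

End Generated.

(** * Shortest sums *)

Section MinimalSupport.
Variables (k : fieldType) (A : algType k) (P Q : ideal A) (E G : A -> Prop).
Hypothesis PQ : forall a, P a -> Q a.
Hypothesis EZ : forall c u, E u -> E (c *: u).
Hypothesis EG : forall h u, G h -> E u -> exists2 c, c != 0 & qcomm P c h u.
Hypothesis GQ : forall h w, G h -> Q (w * h) -> Q w.

(** Let [z] be a shortest sum of terms from [E] lying in [Q] and not in [P],
    and let its terms [u] commute with [h] by the scalars [cf u]. Modulo [P],
    the difference [h * z - cf u0 *: (z * h)] is [w * h], where [w] is the sum
    of the [(cf u - cf u0) *: u]; so [w] is in [Q]. The term [u0] is absent
    from [w], hence [w] is in [P]. Subtracting a multiple of [w] from [z] now
    removes any term whose scalar differs from [cf u0], so there is no such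
    term. *)
Lemma min_support (s : seq A) : (forall u, u \in s -> E u) ->
  Q (\sum_(u <- s) u) -> ~ P (\sum_(u <- s) u) ->
  exists s' : seq A,
    [/\ forall u, u \in s' -> E u /\ ~ P u, Q (\sum_(u <- s') u),
        ~ P (\sum_(u <- s') u)
      & forall h, G h -> exists2 c, c != 0 &
          forall u, u \in s' -> qcomm P c h u].
Proof.
have [N] := ubnP (size s); elim: N s => // N IH s /ltnSE sN sE Qs nPs.
have [[u0 [us Pu]]|nbad] := pselect (exists u, u \in s /\ P u).
  have e : \sum_(u <- s) u = u0 + \sum_(u <- rem u0 s) u.
    by rewrite (perm_big _ (perm_to_rem us)) big_cons.
  apply: (IH (rem u0 s)).
  - by rewrite size_rem //; case: (s) us sN.
  - by move=> u /mem_rem; apply: sE.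
  - by rewrite -(addKr u0 (\sum_(u <- _) u)) -e addrC; apply: idealB => //; apply: PQ.
  by move=> Ps; apply: nPs; rewrite e; apply: idealD.
have [hcom|hn] := pselect (forall h, G h -> exists2 c, c != 0 &
          forall u, u \in s -> qcomm P c h u).
  exists s; split=> // u us; split; first exact: sE.
  by move=> Pu; apply: nbad; exists u.
have [h [Gh hc]] : exists h, G h /\ ~ exists2 c, c != 0 &
    forall u, u \in s -> qcomm P c h u.
  by apply/not_existsP => hh; apply: hn => h Gh; apply: contrapT => hc; apply: (hh h).
have [cf hcf] : exists cf : A -> k, forall u, E u -> cf u != 0 /\ qcomm P (cf u) h u.
  have /choice [cf hcf] : forall u : A, exists c : k,
      E u -> c != 0 /\ qcomm P c h u; last by exists cf.
  move=> u.
  have [Eu|nE] := pselect (E u); last by exists 0.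
  by have [c c0 qc] := EG Gh Eu; exists c.
case: s => [|u0 s] in sN sE Qs nPs nbad hn hc *.
  by case: nPs; rewrite big_nil; apply: ideal0.
have Eu0 : E u0 by apply: sE; rewrite mem_head.
have [c0 qc0] := hcf _ Eu0.
have [u1 [us1 nc1]] : exists u1, u1 \in u0 :: s /\ ~ qcomm P (cf u0) h u1.
  apply/not_existsP => hh; apply: hc; exists (cf u0) => // u us.
  by apply: contrapT => nq; apply: (hh u).
have d1 : cf u1 - cf u0 != 0.
  rewrite subr_eq0; apply/eqP => e; apply: nc1; rewrite -e.
  by case: (hcf u1 (sE _ us1)).
pose z := \sum_(u <- u0 :: s) u.
pose w := \sum_(u <- u0 :: s) (cf u - cf u0) *: u.
have Qw : Q w.
  apply: (GQ Gh).
  apply/(ideal_sub (a := h * z - cf u0 *: (z * h))).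
    apply: PQ; rewrite /w /z !mulr_suml mulr_sumr scaler_sumr -!sumrB.
    rewrite big_seq; apply: (big_ind P); [exact: ideal0|exact: idealD|].
    move=> u us; have [_] := hcf u (sE _ us).
    rewrite /qcomm -scalerAl scalerBl opprB addrA subrK.
    by [].
  by apply: idealB; [apply: idealMl|apply/idealZ/Defs.idealMr].
have [Pw|nPw] := pselect (P w).
  pose cz u := 1 - (cf u1 - cf u0)^-1 * (cf u - cf u0).
  have e : z - (cf u1 - cf u0)^-1 *: w = \sum_(u <- rem u1 (u0 :: s)) cz u *: u.
    rewrite /z /w scaler_sumr -sumrB (perm_big _ (perm_to_rem us1)) big_cons /=.
    rewrite scalerA mulVf // scale1r subrr add0r; apply: eq_bigr => u _.
    by rewrite scalerA scalerBl scale1r.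
  apply: (IH [seq cz u *: u | u <- rem u1 (u0 :: s)]).
  - by rewrite size_map size_rem.
  - by move=> _ /mapP [u /mem_rem us ->]; apply/EZ/sE.
  - by rewrite big_map -e; apply: idealB => //; apply/idealZ/PQ.
  rewrite big_map -e => Pz; apply: nPs.
  by rewrite -(subrK ((cf u1 - cf u0)^-1 *: w) (\sum_(u <- _) u)); apply: idealD => //; apply: idealZ.
have ew : w = \sum_(u <- s) (cf u - cf u0) *: u.
  by rewrite /w big_cons subrr scale0r add0r.
apply: (IH [seq (cf u - cf u0) *: u | u <- s]).
- by rewrite size_map.
- by move=> _ /mapP [u us ->]; apply/EZ/sE; rewrite inE us orbT.
- by rewrite big_map -ew.
by rewrite big_map -ew.
Qed.

End MinimalSupport.

(** * Consequences of the defining relations *)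

Section Relations.
Variables (k : fieldType) (A : algType k) (n : nat).
Variables (p q : 'I_n -> k) (gamma : 'M[k]_n) (g : 'I_n + 'I_n -> A).

Local Notation x i := (g (inl i)).
Local Notation y i := (g (inr i)).

Definition Omega (m : nat) : A :=
  \sum_(l < n | (l < m)%N) (q l - p l) *: (y l * x l).

Hypothesis p0 : forall i, p i != 0.
Hypothesis q0 : forall i, q i != 0.
Hypothesis gamma0 : forall i j, gamma i j != 0.
Hypothesis gammaV : forall i j, gamma j i = (gamma i j)^-1.
Hypothesis nonroot : forall (i : 'I_n) (m : nat), (p i / q i) ^+ m.+1 != 1.

Hypothesis yy : forall i j, y i * y j = gamma i j *: (y j * y i).
Hypothesis xy_lt : forall i j : 'I_n, (i < j)%N ->
  x i * y j = (p j * gamma j i) *: (y j * x i).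
Hypothesis xy_gt : forall i j : 'I_n, (j < i)%N ->
  x i * y j = (q j * gamma j i) *: (y j * x i).
Hypothesis xx : forall i j : 'I_n, (i < j)%N ->
  x i * x j = (q i * (p j)^-1 * gamma i j) *: (x j * x i).
Hypothesis xy : forall i, x i * y i = q i *: (y i * x i) + Omega i.
Hypothesis gen : generates g.

Lemma Omega0 : Omega 0 = 0.
Proof. by rewrite /Omega big_pred0. Qed.

Lemma OmegaS (i : 'I_n) : Omega i.+1 = Omega i + (q i - p i) *: (y i * x i).
Proof.
rewrite /Omega (bigD1 i) //= addrC; congr (_ + _); apply: eq_bigl => l.
by rewrite ltnS ltn_neqAle andbC.
Qed.

Lemma xyS i : x i * y i = p i *: (y i * x i) + Omega i.+1.
Proof. by rewrite xy OmegaS scalerBl [RHS]addrC -addrA subrK addrC. Qed.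

Lemma xx_gt (i j : 'I_n) : (j < i)%N ->
  x i * x j = ((q j)^-1 * p i * gamma i j) *: (x j * x i).
Proof.
move=> ji; rewrite (xx ji) scalerA (gammaV i j) -[LHS]scale1r; congr (_ *: _).
by field; rewrite p0 q0 gamma0.
Qed.

(** The scalar by which [Omega m] commutes with [y_j]; its inverse is the one
    for [x_j]. *)
Definition weight (m : nat) (j : 'I_n) : k := if (j < m)%N then q j else p j.

Lemma weight_lt m (j : 'I_n) : (j < m)%N -> weight m j = q j.
Proof. by rewrite /weight => ->. Qed.

Lemma weight_ge m (j : 'I_n) : (m <= j)%N -> weight m j = p j.
Proof. by rewrite /weight leqNgt => /negPf ->. Qed.

Lemma weight_neq0 m j : weight m j != 0.
Proof. by rewrite /weight; case: ifP. Qed.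

(** Adding the summand of index [i = m] to [Omega m] alters the weight of [y_i]
    only, from [p_i] to [q_i]; this is the case where the summand does not
    itself commute with [y_i] up to a scalar. *)
Lemma Omega_y m (j : 'I_n) : (m <= n)%N ->
  Omega m * y j = weight m j *: (y j * Omega m).
Proof.
elim: m => [|m IH] mn; first by rewrite Omega0 mul0r mulr0 scaler0.
have {}IH := IH (ltnW mn); pose i := Ordinal mn.
rewrite -[m.+1]/(i.+1) OmegaS mulrDl IH mulrDr [RHS]scalerDr.
rewrite -scalerAl -scalerAr scalerA /=.
have [ji|ij|ij] := ltngtP (j : nat) m.
- rewrite !weight_lt //; last exact: leqW.
  rewrite -[y i * x i * _]mulrA (@xy_gt i j) // -scalerAr !mulrA (yy i j).
  rewrite -scalerAl !scalerA; congr (_ + _ *: _).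
  by rewrite (gammaV i j); field; apply: gamma0.
- rewrite !weight_ge //; last exact: ltnW.
  rewrite -[y i * x i * _]mulrA (@xy_lt i j) // -scalerAr !mulrA (yy i j).
  rewrite -scalerAl !scalerA; congr (_ + _ *: _).
  by rewrite (gammaV i j); field; apply: gamma0.
have {ij}<- : i = j by apply: val_inj.
rewrite (@weight_lt m.+1) // weight_ge // -mulrA xy -[i : nat]/m.
rewrite mulrDr -scalerAr scalerDr scalerA addrCA -scalerDl.
rewrite addrC; congr (_ + _); last by rewrite mulrC.
by rewrite addrC subrK.
Qed.

Lemma x_Omega m (j : 'I_n) : (m <= n)%N ->
  x j * Omega m = weight m j *: (Omega m * x j).
Proof.
elim: m => [|m IH] mn; first by rewrite Omega0 mul0r mulr0 scaler0.
have {}IH := IH (ltnW mn); pose i := Ordinal mn.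
rewrite -[m.+1]/(i.+1) OmegaS mulrDr IH mulrDl [RHS]scalerDr.
rewrite -scalerAl -scalerAr scalerA /=.
have [ji|ij|ij] := ltngtP (j : nat) m.
- rewrite !weight_lt //; last exact: leqW.
  rewrite mulrA (@xy_lt j i) // -scalerAl -mulrA (@xx j i) //.
  rewrite -scalerAr !scalerA !mulrA; congr (_ + _ *: _).
  by rewrite (gammaV i j); field; rewrite gamma0 p0.
- rewrite !weight_ge //; last exact: ltnW.
  rewrite mulrA (@xy_gt j i) // -scalerAl -mulrA (@xx_gt j i) //.
  rewrite -scalerAr !scalerA !mulrA; congr (_ + _ *: _).
  by rewrite (gammaV i j); field; rewrite gamma0 q0.
have {ij}<- : i = j by apply: val_inj.
rewrite (@weight_lt m.+1) // weight_ge // mulrA xy -[i : nat]/m.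
rewrite mulrDl -scalerAl scalerDr scalerA addrCA -scalerDl.
rewrite addrC; congr (_ + _); last by rewrite mulrC.
by rewrite addrC subrK.
Qed.


Lemma yx_comm (i j : 'I_n) : i != j ->
  exists2 c, c != 0 & x i * y j = c *: (y j * x i).
Proof.
rewrite -val_eqE /= neq_ltn => /orP [ij|ji].
  by exists (p j * gamma j i); [rewrite mulf_neq0|exact: xy_lt].
by exists (q j * gamma j i); [rewrite mulf_neq0|exact: xy_gt].
Qed.

Lemma xx_comm (i j : 'I_n) : exists2 c, c != 0 & x i * x j = c *: (x j * x i).
Proof.
have [ij|ji|/val_inj ->] := ltngtP i j.
- exists (q i * (p j)^-1 * gamma i j); last exact: xx.
  by rewrite !mulf_neq0 ?invr_eq0.
- exists ((q j)^-1 * p i * gamma i j); last exact: xx_gt.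
  by rewrite !mulf_neq0 ?invr_eq0.
by exists 1; rewrite ?scale1r ?oner_neq0.
Qed.

Lemma comm_sym (a b : A) : (exists2 c, c != 0 & a * b = c *: (b * a)) ->
  exists2 c : k, c != 0 & b * a = c *: (a * b).
Proof.
by case=> c c0 ->; exists c^-1; rewrite ?invr_eq0 // scalerA mulVf // scale1r.
Qed.

Lemma yy_comm (i j : 'I_n) : exists2 c, c != 0 & y i * y j = c *: (y j * y i).
Proof. by exists (gamma i j). Qed.

Lemma Omega_eigen (P : ideal A) m : (m <= n)%N -> eigen g P (Omega m).
Proof.
move=> mn [j|j]; first by exists (weight m j); rewrite ?weight_neq0 //; apply/qcomm_eq/x_Omega.
exists (weight m j)^-1; first by rewrite invr_eq0 weight_neq0.
by apply: qcommV; [exact: weight_neq0|apply/qcomm_eq/Omega_y].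
Qed.

(** If [Omega i] or [Omega i.+1] vanishes modulo [P], then [x_i] and [y_i]
    commute up to a scalar as well, and nothing else obstructs normality. *)
Lemma degenerate_eigen (P : ideal A) (i : 'I_n) : P (Omega i) \/ P (Omega i.+1) ->
  eigen g P (x i) /\ eigen g P (y i).
Proof.
move=> hP.
have [c c0 hc] : exists2 c, c != 0 & qcomm P c (x i) (y i).
  case: hP => hP; [exists (q i) => //|exists (p i) => //].
    by rewrite /qcomm xy addrC addKr.
  by rewrite /qcomm xyS addrC addKr.
have exact_comm (a b : A) : (exists2 c, c != 0 & a * b = c *: (b * a)) ->
    exists2 c, c != 0 & qcomm P c a b.
  by case=> d d0 e; exists d => //; apply: qcomm_eq.
split=> -[] j.
- exact/exact_comm/xx_comm.
- have [->|ij] := eqVneq j i.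
    by exists c^-1; [rewrite invr_eq0|exact: qcommV].
  by apply/exact_comm/comm_sym/yx_comm; rewrite eq_sym.
- have [->|ij] := eqVneq j i; first by exists c.
  exact/exact_comm/yx_comm.
exact/exact_comm/yy_comm.
Qed.

(** * The algebra is left noetherian *)

Section Noetherianity.

Fixpoint initial_gens (m : nat) : seq A :=
  if m is m'.+1 then
    if insub m' is Some i then [:: x i, y i & initial_gens m'] else initial_gens m'
  else [::].

Lemma initial_gensS (i : 'I_n) :
  initial_gens i.+1 = [:: x i, y i & initial_gens i].
Proof. by rewrite /= (valK i). Qed.

Lemma initial_gensP m a : (m <= n)%N -> a \in initial_gens m ->
  exists j : 'I_n, (j < m)%N /\ (a = x j \/ a = y j).
Proof.
elim: m => // m IH mn; rewrite (initial_gensS (Ordinal mn)) !inE.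
case/or3P => [/eqP ->|/eqP ->|am]; [exists (Ordinal mn)..|].
- by split=> //; left.
- by split=> //; right.
have [j [jm hj]] := IH (ltnW mn) am.
by exists j; split=> //; apply: leqW.
Qed.

Lemma mem_initial_gens m (j : 'I_n) : (m <= n)%N -> (j < m)%N ->
  (x j \in initial_gens m) && (y j \in initial_gens m).
Proof.
elim: m => // m IH mn; rewrite (initial_gensS (Ordinal mn)) !inE ltnS leq_eqVlt.
case/orP => [jm|jm].
  have -> : j = Ordinal mn by apply/val_inj/eqP.
  by rewrite !eqxx !orbT.
by have /andP [-> ->] := IH (ltnW mn) jm; rewrite !orbT.
Qed.

(** The order [y_0, x_0, y_1, x_1, ...] of adjunction works because the only
    correction term, in [x_i y_i], is [Omega i], which involves smaller
    indices. *)
Lemma initial_gens_tower m : (m <= n)%N -> is_tower (initial_gens m).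
Proof.
elim: m => // m IH mn; have {}IH := IH (ltnW mn); pose i := Ordinal mn.
rewrite (initial_gensS i).
have qstep (l : seq A) (s t : A) : is_tower l -> s \in l ->
    (exists2 c, c != 0 & s * t = c *: (t * s)) ->
    (exists r1 r2, [/\ tower_ring l r1, tower_ring l r2 & s * t = t * r1 + r2])
    /\ (exists r1 r2, [/\ tower_ring l r1, tower_ring l r2 & t * s = r1 * t + r2]).
  move=> /is_towerP [hs _ hc hl] sl [c c0 e]; have [_ _ hM] := hs.
  have hZ d : tower_ring l (d *: s).
    by rewrite -[s]mul1r scalerAl; apply: hM; [exact: hc|exact: hl].
  split; [exists (c *: s), 0|exists (c^-1 *: s), 0]; split=> //;
    try exact: subring0.
    by rewrite addr0 -scalerAr.
  by rewrite addr0 -scalerAl e scalerA mulVf // scale1r.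
have ty : is_tower (y i :: initial_gens i).
  split=> // s hs; apply: qstep => //.
  have [j [ji [->|->]]] := initial_gensP (ltnW mn) hs; last exact: yy_comm.
  by apply: yx_comm; rewrite -val_eqE /= neq_ltn ji.
split=> // s; rewrite inE => /orP [/eqP ->|hs]; last first.
  apply: qstep; [exact: ty|by rewrite inE hs orbT|].
  have [j [ji [->|->]]] := initial_gensP (ltnW mn) hs; first exact: xx_comm.
  by apply/comm_sym/yx_comm; rewrite eq_sym -val_eqE /= neq_ltn ji.
have [hs _ hc hl] := is_towerP ty; have [_ _ hM] := hs.
have hZ d a : tower_ring (y i :: initial_gens i) a ->
    tower_ring (y i :: initial_gens i) (d *: a).
  by move=> ha; rewrite -[a]mul1r scalerAl; apply: hM; first exact: hc.
have hO : tower_ring (y i :: initial_gens i) (Omega i).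
  apply: (big_ind (tower_ring (y i :: initial_gens i))); first exact: subring0.
    by move=> a b; apply: subringD.
  move=> l li; have /andP [xl yl] := mem_initial_gens (ltnW mn) li.
  by apply/hZ/hM; apply: hl; rewrite inE (xl, yl) orbT.
have hy := hl _ (mem_head _ _).
split; last by exists (q i *: y i), (Omega i); split=> //; [exact: hZ|rewrite -scalerAl -xy].
exists ((q i)^-1 *: y i), (- (q i)^-1 *: Omega i); split; [exact: hZ|exact: hZ|].
rewrite -scalerAr xy scalerDr scalerA mulVf // scale1r scaleNr.
by rewrite addrK.
Qed.

Lemma relations_noetherian : noetherian (fun _ : A => True).
Proof.
have [hs hn hc hl] := is_towerP (initial_gens_tower (leqnn n)).
have [h1 _ hM] := hs.
have hA : forall a, tower_ring (initial_gens n) a.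
  apply: gen => //.
  - by move=> a b; apply: subringD.
  - by move=> c a ha; rewrite -[a]mul1r scalerAl; apply: hM.
  move=> i a ha; apply: (hM) => //; apply: hl.
  by case: i => i; have /andP [] := mem_initial_gens (leqnn n) (ltn_ord i).
move=> I hI mI; apply: hn => // m; have [_ I0 IB IM] := hI m.
by split=> // r a _; apply: IM.
Qed.

End Noetherianity.

(** * Regularity of the generators modulo a prime ideal *)

Section Regularity.
Variables (Q : ideal A) (i : 'I_n).
Hypothesis pQ : prime_ideal Q.
Hypothesis nQ : ~ Q (Omega i).

Lemma comm_ore (a t : A) m : (exists2 c : k, c != 0 & a * t = c *: (t * a)) ->
  exists r, a * t ^+ m.+1 = t ^+ m * r.
Proof.
case=> c _ e.
have {}e l : a * t ^+ l = c ^+ l *: (t ^+ l * a).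
  elim: l => [|l IH]; first by rewrite mulr1 mul1r scale1r.
  by rewrite exprS mulrA e -scalerAl -(mulrA t a) IH -scalerAr scalerA exprS !mulrA.
exists (c ^+ m.+1 *: (t * a)).
by rewrite e -scalerAr mulrA -exprSr.
Qed.

Let pqX m : q i ^+ m.+1 != p i ^+ m.+1.
Proof.
apply: contra_neq (nonroot i m) => e.
by rewrite expr_div_n -e divff // expf_neq0.
Qed.

Lemma y_regular w : Q (w * y i) -> Q w.
Proof.
have oy : Omega i * y i = p i *: (y i * Omega i).
  by rewrite Omega_y ?weight_ge // ltnW.
apply: (ore_regular gen relations_noetherian pQ).
  case=> j m; last exact/comm_ore/yy_comm.
  have [->|ij] := eqVneq j i; last exact/comm_ore/yx_comm.
  have [c [_ ->]] := skew_power (xy i) oy m.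
  exists (q i ^+ m.+1 *: (y i * x i) + c *: Omega i).
  by rewrite mulrDr -!scalerAr mulrA -exprSr.
apply: (skew_powers_notin gen (xy i) oy pqX pQ) => //.
exact/Omega_eigen/ltnW.
Qed.

Lemma x_regular w : Q (w * x i) -> Q w.
Proof.
have yx : y i * x i = (q i)^-1 *: (x i * y i) + (- (q i)^-1) *: Omega i.
  by rewrite xy scalerDr scalerA mulVf // scale1r scaleNr addrK.
have ox : ((- (q i)^-1) *: Omega i) * x i
    = (p i)^-1 *: (x i * ((- (q i)^-1) *: Omega i)).
  rewrite -scalerAl -scalerAr x_Omega ?weight_ge //; last exact: ltnW.
  by rewrite !scalerA mulrAC mulVf // mul1r.
apply: (ore_regular gen relations_noetherian pQ).
  case=> j m; first exact/comm_ore/xx_comm.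
  have [->|ij] := eqVneq j i; last by apply/comm_ore/comm_sym/yx_comm; rewrite eq_sym.
  have [c [_ ->]] := skew_power yx ox m.
  exists ((q i)^-1 ^+ m.+1 *: (x i * y i) + c *: ((- (q i)^-1) *: Omega i)).
  by rewrite mulrDr -!scalerAr mulrA -exprSr.
apply: (skew_powers_notin gen yx ox) => // [m||].
- by rewrite !exprVn (inj_eq invr_inj).
- exact/eigenZ/Omega_eigen/ltnW.
move=> hQ; apply: nQ; rewrite -(scalerK (a := - (q i)^-1) _ (Omega i)).
  exact: idealZ.
by rewrite oppr_eq0 invr_eq0.
Qed.

End Regularity.


(** * Words in the y's *)

Definition yword (w : seq 'I_n) : A := \prod_(i <- w) y i.

Lemma yword_perm (w w' : seq 'I_n) : perm_eq w w' ->
  exists2 c, c != 0 & yword w' = c *: yword w.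
Proof.
have cat i w1 w2 : exists2 c : k, c != 0 &
    yword (w1 ++ i :: w2) = c *: (y i * yword (w1 ++ w2)).
  elim: w1 => [|j w1 [c c0 IH]].
    by exists 1; rewrite ?oner_neq0 // /yword big_cons scale1r.
  exists (c * gamma j i); first by rewrite mulf_neq0.
  rewrite {1}/yword /= big_cons -/(yword _) IH /yword big_cons -scalerAr !mulrA.
  by rewrite (yy j i) -scalerAl scalerA.
elim: w w' => [|i w IH] w' hw.
  move: hw; rewrite perm_sym => /perm_nilP ->.
  by exists 1; rewrite ?oner_neq0 ?scale1r.
have iw' : i \in w' by rewrite -(perm_mem hw) mem_head.
case/splitPr: iw' hw => w1 w2; rewrite perm_sym -cat1s perm_catCA /= perm_cons.
rewrite perm_sym => /IH [c c0 e]; have [d d0 e'] := cat i w1 w2.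
exists (d * c); first by rewrite mulf_neq0.
by rewrite e' e -scalerAr scalerA /yword big_cons.
Qed.

Lemma Omega_yword m w : (m <= n)%N ->
  Omega m * yword w = (\prod_(i <- w) weight m i) *: (yword w * Omega m).
Proof.
move=> mn; rewrite /yword; elim: w => [|i w IH].
  by rewrite !big_nil mulr1 mul1r scale1r.
rewrite !big_cons mulrA Omega_y // -scalerAl -(mulrA (y i) (Omega m)) IH.
by rewrite -scalerAr scalerA !mulrA.
Qed.

(** [Omega i.+1] and [Omega i] have the same weight on every [y_j] except
    [y_i], so comparing them on a word counts the occurrences of [y_i]. *)
Lemma weight_ratio (i : 'I_n) (w : seq 'I_n) :
  (\prod_(j <- w) weight i.+1 j) * p i ^+ count_mem i w
  = (\prod_(j <- w) weight i j) * q i ^+ count_mem i w.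
Proof.
elim: w => [|j w IH]; first by rewrite !big_nil.
rewrite !big_cons /= !exprD mulrACA IH [RHS]mulrACA; congr (_ * _).
have [->|ij] := eqVneq j i; first by rewrite weight_lt // weight_ge // mulrC.
by rewrite !mulr1 /weight ltnS leq_eqVlt -[_ == _]/(j == i) (negPf ij).
Qed.

(** Both elements are combinations of [x_i y_i] and [y_i x_i], on which [v]
    acts by the same scalar. So the ratio of the two scalars sees only the word
    in a product of [v] with a word. *)
Lemma eigen_Omega_pair (P : ideal A) (i : 'I_n) v : eigen g P v ->
  exists2 d, d != 0 & qcomm P d (Omega i) v /\ qcomm P d (Omega i.+1) v.
Proof.
move=> hv; have [c c0 hc] := hv (inl i); have [d d0 hd] := hv (inr i).
exists (c * d); first by rewrite mulf_neq0.
have hxy : qcomm P (c * d) (x i * y i) v by apply: qcommMl.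
have hyx a : qcomm P (c * d) (a *: (y i * x i)) v.
  by apply: qcommZl; rewrite mulrC; apply: qcommMl.
have e : Omega i = x i * y i + (- q i) *: (y i * x i).
  by rewrite xy scaleNr addrAC subrr add0r.
have e' : Omega i.+1 = x i * y i + (- p i) *: (y i * x i).
  by rewrite xyS scaleNr addrAC subrr add0r.
by rewrite e e'; split; apply: qcommDl.
Qed.

Lemma q_neq_p i : q i - p i != 0.
Proof.
rewrite subr_eq0; apply: contra_neq (nonroot i 0) => e.
by rewrite expr1 -e divff.
Qed.

Lemma gen_product i :
  x i * y i = (q i - p i)^-1 *: (q i *: Omega i.+1 - p i *: Omega i).
Proof.
rewrite OmegaS xy (scalerDr (q i)) addrAC -scalerBl scalerDr !scalerA mulVf ?q_neq_p //.
by rewrite scale1r mulrCA mulVf ?q_neq_p // mulr1 addrC.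
Qed.

(** * Separating two prime ideals *)

Section Separation.
Variables P Q : ideal A.
Hypothesis pP : prime_ideal P.
Hypothesis pQ : prime_ideal Q.
Hypothesis PQ : forall a, P a -> Q a.
(* To be contradicted when [Q] differs from [P]. *)
Hypothesis eigenQP : forall u, eigen g P u -> Q u -> P u.

Definition generic_index (i : 'I_n) := ~ P (Omega i) /\ ~ P (Omega i.+1).

Lemma eigen_regularQ u w : eigen g P u -> ~ P u -> Q (w * u) -> Q w.
Proof.
move=> hu nPu; apply: (eigen_regular gen pQ); first exact: eigen_subset hu.
by move=> /(eigenQP hu).
Qed.

Lemma nongeneric_eigen i : ~ generic_index i ->
  eigen g P (x i) /\ eigen g P (y i).
Proof.
move=> deg; apply: degenerate_eigen.
have [|n1] := pselect (P (Omega i)); first by left.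
by right; apply: contrapT => n2; apply: deg.
Qed.

Lemma gen_regularQ t w : ~ P (g t) -> Q (w * g t) -> Q w.
Proof.
have nQ i : generic_index i -> ~ Q (Omega i).
  by move=> [ni _] /(eigenQP (Omega_eigen P (ltnW (ltn_ord i)))).
case: t => i nPt; have [gi|/nongeneric_eigen [hx hy]] := pselect (generic_index i).
- by apply: x_regular => //; exact: nQ.
- exact: eigen_regularQ.
- by apply: y_regular => //; exact: nQ.
exact: eigen_regularQ.
Qed.

Lemma generic_y_notin i : generic_index i -> ~ P (y i).
Proof.
move=> [ni _] Py; apply: ni.
have -> : Omega i = x i * y i - q i *: (y i * x i) by rewrite xy addrAC subrr add0r.
by apply: idealB; [apply: idealMl|apply/idealZ/Defs.idealMr].
Qed.

Lemma generic_yword_regular w a : (forall i, i \in w -> generic_index i) ->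
  (Q (a * yword w) -> Q a) /\ (P (a * yword w) -> P a).
Proof.
rewrite /yword; elim/last_ind: w a => [|w i IH] a hw.
  by rewrite big_nil mulr1.
have hi : generic_index i by apply: hw; rewrite mem_rcons mem_head.
have [hQ hP] : (Q (a * yword w) -> Q a) /\ (P (a * yword w) -> P a).
  by apply: IH => j jw; apply: hw; rewrite mem_rcons inE jw orbT.
rewrite big_rcons mulrA; split.
  by move=> /(gen_regularQ (t := inr i) (generic_y_notin hi)).
by move=> /(y_regular pP (proj1 hi)).
Qed.

(** Monomials of the quantum torus that remains modulo [P] once the generic
    [x_i] have been eliminated. *)
Definition torus_term u := exists v w, [/\ eigen g P v,
  forall i, i \in w -> generic_index i & u = v * yword w].

Definition torus_span z := exists2 s : seq A,
  forall u, u \in s -> torus_term u & P (z - \sum_(u <- s) u).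

Lemma torus_termZ c u : torus_term u -> torus_term (c *: u).
Proof.
case=> v [w [hv hw ->]]; exists (c *: v), w; split=> //; first exact: eigenZ.
by rewrite scalerAl.
Qed.

Lemma torus_spanP z z' : P (z - z') -> torus_span z' -> torus_span z.
Proof.
move=> hz [s hs hP]; exists s => //.
by rewrite -(subrKA z'); apply: idealD.
Qed.

Lemma torus_span_term u : torus_term u -> torus_span u.
Proof.
move=> hu; exists [:: u]; first by move=> v; rewrite inE => /eqP ->.
by rewrite big_seq1 subrr; apply: ideal0.
Qed.

Lemma torus_span0 z : P z -> torus_span z.
Proof. by move=> Pz; exists [::] => //; rewrite big_nil subr0. Qed.

Lemma torus_spanD z z' : torus_span z -> torus_span z' -> torus_span (z + z').
Proof.
case=> s hs hP [s' hs' hP']; exists (s ++ s').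
  by move=> u; rewrite mem_cat => /orP []; [apply: hs|apply: hs'].
by rewrite big_cat /= opprD addrACA; apply: idealD.
Qed.

Lemma torus_spanM a b z : (forall u, torus_term u -> torus_span (a * u * b)) ->
  torus_span z -> torus_span (a * z * b).
Proof.
move=> hab [s hs hP].
apply: (torus_spanP (z' := a * (\sum_(u <- s) u) * b)).
  by rewrite -mulrBl -mulrBr; apply: idealMlr.
rewrite mulr_sumr mulr_suml big_seq.
apply: (big_ind torus_span); [exact/torus_span0/ideal0|exact: torus_spanD|].
by move=> u us; apply/hab/hs.
Qed.

Lemma torus_spanZ c z : torus_span z -> torus_span (c *: z).
Proof.
move=> hz; rewrite -[z]mul1r scalerAl -[_ * z]mulr1; apply: torus_spanM hz => u hu.
by rewrite mulr1 -scalerAl mul1r; apply/torus_span_term/torus_termZ.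
Qed.

Lemma torus_span_yword w z : (forall i, i \in w -> generic_index i) ->
  torus_span z -> torus_span (z * yword w).
Proof.
move=> hw hz; rewrite -[z]mul1r; apply: torus_spanM hz => _ [v [w' [hv hw' ->]]].
apply: torus_span_term; exists v, (w' ++ w); split=> //.
  by move=> i; rewrite mem_cat => /orP []; [apply: hw'|apply: hw].
by rewrite mul1r -mulrA /yword big_cat.
Qed.

Lemma torus_span_eigen u z :
  eigen g P u -> torus_span z -> torus_span (u * z).
Proof.
move=> hu hz; rewrite -[u * z]mulr1; apply: torus_spanM hz => _ [v [w [hv hw ->]]].
apply: torus_span_term; rewrite mulr1 mulrA; exists (u * v), w; split=> //.
exact: eigenM.
Qed.

Lemma torus_span_y i z :
  generic_index i -> torus_span z -> torus_span (y i * z).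
Proof.
move=> hi hz; rewrite -[y i * z]mulr1; apply: torus_spanM hz => _ [v [w [hv hw ->]]].
rewrite mulr1; have [c c0 hc] := hv (inr i).
apply: (torus_spanP (z' := c *: (v * yword (i :: w)))).
  rewrite /yword big_cons -/(yword w) !mulrA.
  by rewrite scalerAl -mulrBl; apply: Defs.idealMr.
apply/torus_spanZ/torus_span_term; exists v, (i :: w); split=> //.
by move=> j; rewrite inE => /orP [/eqP ->|]; last exact: hw.
Qed.

(** Moved next to each other, [x_i] and [y_i] merge into a combination of
    [Omega i] and [Omega i.+1], which are eigen elements. *)
Lemma torus_span_xy i z : torus_span z -> generic_index i ->
  torus_span (x i * z * y i).
Proof.
move=> hz hi; apply: torus_spanM hz => _ [v [w [hv hw ->]]].
have [c c0 hc] := hv (inl i).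
have [d d0 hd] := yword_perm (permEl (perm_catC [:: i] w)).
apply: (torus_spanP (z' := d *: (c *: (v * (x i * y i) * yword w)))).
  have -> : x i * (v * yword w) * y i = d *: (x i * v * (y i * yword w)).
    have -> : y i * yword w = yword ([:: i] ++ w) by rewrite /yword big_cons.
    by rewrite scalerAr -hd /yword big_cat big_seq1 !mulrA.
  rewrite -scalerBr; apply: idealZ.
  have -> : x i * v * (y i * yword w) - c *: (v * (x i * y i) * yword w)
    = (x i * v - c *: (v * x i)) * (y i * yword w).
    by rewrite mulrBl -!scalerAl !mulrA.
  exact: Defs.idealMr.
have hO m : (m <= n)%N -> torus_span (v * Omega m * yword w).
  move=> mn; apply: torus_span_term; exists (v * Omega m), w; split=> //.
  by apply: eigenM => //; apply: Omega_eigen.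
apply/torus_spanZ/torus_spanZ; rewrite gen_product.
rewrite -scalerAr -scalerAl mulrBr mulrBl -!scalerAr -!scalerAl -scaleNr.
by apply/torus_spanZ/torus_spanD; apply/torus_spanZ/hO => //; apply: ltnW.
Qed.

(** Each factor [x_i] with [i] generic is absorbed by one [y_i] on the right.
    *)
Lemma torus_reach z : exists2 w,
  forall i, i \in w -> generic_index i & torus_span (z * yword w).
Proof.
move: z; apply: gen.
- exists [::] => //; apply: torus_span_term; exists 1, [::]; split=> //.
  exact: eigen1.
- move=> a b [wa ha sa] [wb hb sb]; exists (wa ++ wb).
    by move=> i; rewrite mem_cat => /orP []; [apply: ha|apply: hb].
  rewrite mulrDl; apply: torus_spanD.
    by rewrite /yword big_cat mulrA; apply: torus_span_yword.
  have [c c0 e] := yword_perm (permEl (perm_catC wb wa)).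
  rewrite e -scalerAr; apply: torus_spanZ.
  by rewrite /yword big_cat mulrA; apply: torus_span_yword.
- by move=> c a [w hw sw]; exists w => //; rewrite -scalerAl; apply: torus_spanZ.
case=> i a [w hw sw]; have [gi|/nongeneric_eigen [hx hy]] := pselect (generic_index i).
- exists (rcons w i).
    by move=> j; rewrite mem_rcons inE => /orP [/eqP ->|]; last exact: hw.
  rewrite /yword big_rcons -/(yword w) mulrA -(mulrA _ a); exact: torus_span_xy.
- by exists w => //; rewrite -mulrA; apply: torus_span_eigen.
- by exists w => //; rewrite -mulrA; apply: torus_span_y.
by exists w => //; rewrite -mulrA; apply: torus_span_eigen.
Qed.

Lemma term_degree (i : 'I_n) v w c c' : eigen g P v ->
  generic_index i -> ~ P (v * yword w) ->
  qcomm P c (Omega i) (v * yword w) -> qcomm P c' (Omega i.+1) (v * yword w) ->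
  c' * p i ^+ count_mem i w = c * q i ^+ count_mem i w.
Proof.
move=> hv [ni ni'] nPu hc hc'; have [d d0 [hd hd']] := eigen_Omega_pair i hv.
have scal m e : (m <= n)%N -> ~ P (Omega m) -> qcomm P d (Omega m) v ->
    qcomm P e (Omega m) (v * yword w) -> e = d * \prod_(j <- w) weight m j.
  move=> mn nPm hm he; apply: (qcomm_uniq he).
    by apply: qcommMr hm _; apply/qcomm_eq/Omega_yword.
  by move=> /(eigen_regular gen pP (Omega_eigen P mn) nPm).
have -> := scal i c (ltnW (ltn_ord i)) ni hd hc.
have -> := scal i.+1 c' (ltn_ord i) ni' hd' hc'.
by rewrite -!mulrA weight_ratio.
Qed.

Lemma degree_inj (i : 'I_n) (c c' : k) m m' : c != 0 ->
  c' * p i ^+ m = c * q i ^+ m -> c' * p i ^+ m' = c * q i ^+ m' -> m = m'.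
Proof.
move=> c0; wlog mm' : m m' / (m <= m')%N.
  by move=> H e e'; case/orP: (leq_total m m') => h; [|apply/esym]; apply: H.
rewrite -(subnKC mm'); case: (m' - m)%N => [|e] h; first by rewrite addn0.
rewrite !exprD mulrA h -!mulrA => /(mulfI c0) /(mulfI (expf_neq0 m (q0 i))) he.
by case/negP: (nonroot i e); rewrite expr_div_n he divff // expf_neq0.
Qed.

Lemma generic_Omega_scalar (i : 'I_n) u : torus_term u ->
  (exists2 c, c != 0 & qcomm P c (Omega i) u) /\
  (exists2 c, c != 0 & qcomm P c (Omega i.+1) u).
Proof.
case=> v [w [hv _ ->]]; have [d d0 [hd hd']] := eigen_Omega_pair i hv.
have wn0 m : \prod_(j <- w) weight m j != 0.
  by elim/big_ind: _ => [|a b a0 b0|j _]; rewrite ?oner_neq0 ?mulf_neq0 ?weight_neq0.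
split; [exists (d * \prod_(j <- w) weight i j)|exists (d * \prod_(j <- w) weight i.+1 j)];
  rewrite ?mulf_neq0 //; apply: qcommMr => //; apply/qcomm_eq/Omega_yword => //.
exact: ltnW.
Qed.

(** In a shortest sum of torus terms all words have the same degrees, so they
    equal one fixed word up to scalars, and that word can be cancelled. *)
Lemma eigen_sum_exists z : Q z -> ~ P z -> exists s : seq A,
  [/\ forall u, u \in s -> eigen g P u, Q (\sum_(u <- s) u) & ~ P (\sum_(u <- s) u)].
Proof.
move=> Qz nPz; have [w hw [s hs hP]] := torus_reach z.
have Qs : Q (\sum_(u <- s) u).
  by apply/(ideal_sub (PQ hP)); apply: Defs.idealMr.
have nPs : ~ P (\sum_(u <- s) u).
  by move=> /(ideal_sub hP) /(proj2 (generic_yword_regular _ hw)).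
pose G h := exists2 i : 'I_n, generic_index i & h = Omega i \/ h = Omega i.+1.
have [| |s' [hs' Qs' nPs' hG]] :=
  min_support (G := G) PQ torus_termZ _ _ hs Qs nPs.
- by move=> h u [i _ hi] /(generic_Omega_scalar i) [h1 h2]; case: hi => ->.
- move=> h a [i [n1 n2] hi]; case: hi => ->; apply: eigen_regularQ => //;
    apply: Omega_eigen => //; exact: ltnW.
case: s' => [|u0 s'] in hs' Qs' nPs' hG *.
  by case: nPs'; rewrite big_nil; apply: ideal0.
have [[v0 [w0 [hv0 hw0 e0]]] nP0] := hs' _ (mem_head u0 s').
have common u : exists v, u \in u0 :: s' -> eigen g P v /\ u = v * yword w0.
  have [us|nus] := boolP (u \in u0 :: s'); last by exists 0.
  have [[v [w' [hv hw' e]]] nPu] := hs' _ us.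
  suff /yword_perm [c c0 e'] : perm_eq w0 w'.
    exists (c *: v) => _; split; first exact: eigenZ.
    by rewrite e e' -scalerAl -scalerAr.
  apply/allP => i; rewrite mem_cat => hi; apply/eqP.
  have gi : generic_index i by case/orP: hi; [apply: hw0|apply: hw'].
  have [c c0 hc] := hG (Omega i) (ex_intro2 _ _ i gi (or_introl erefl)).
  have [c' c0' hc'] := hG (Omega i.+1) (ex_intro2 _ _ i gi (or_intror erefl)).
  apply: (degree_inj (i := i) c0 (c' := c')).
    by apply: (term_degree hv0) => //; rewrite -e0 //; [apply: hc|apply: hc'];
      rewrite mem_head.
  by apply: (term_degree hv) => //; rewrite -e //; [apply: hc|apply: hc'].
have [f hf] := choice common.
have ef : \sum_(u <- u0 :: s') u = (\sum_(u <- u0 :: s') f u) * yword w0.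
  rewrite mulr_suml !big_seq; apply: eq_bigr => u us.
  by case: (hf u us).
exists [seq f u | u <- u0 :: s']; split.
- by move=> _ /mapP [u us ->]; case: (hf u us).
- rewrite big_map; apply: (proj1 (generic_yword_regular _ hw0)).
  by rewrite -ef.
by rewrite big_map => Pf; apply: nPs'; rewrite ef; apply: Defs.idealMr.
Qed.

(** A shortest sum of eigen elements commutes with each generator outside [P]
    by a single scalar, so it is itself an eigen element, and [Q] has none
    outside [P]. *)
Lemma eigen_separates z : Q z -> P z.
Proof.
move=> Qz; apply: contrapT => nPz.
have [s [hs Qs nPs]] := eigen_sum_exists Qz nPz.
pose G h := exists2 t, ~ P (g t) & h = g t.
have [| |s' [hs' Qs' nPs' hG]] :=
  min_support (G := G) PQ (@eigenZ _ _ _ g P) _ _ hs Qs nPs.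
- by move=> h u [t _ ->]; apply.
- by move=> h a [t nt ->]; apply: gen_regularQ.
apply/nPs'/eigenQP => // t.
have [Pt|nPt] := pselect (P (g t)).
  exists 1; first exact: oner_neq0.
  by rewrite /qcomm scale1r; apply: idealB; [apply: Defs.idealMr|apply: idealMl].
have [c c0 hc] := hG (g t) (ex_intro2 _ _ t nPt erefl).
by exists c => //; apply: qcomm_sum.
Qed.

End Separation.

Theorem relations_normally_separated : normally_separated A.
Proof.
move=> P Q pP pQ [PQ nQP]; apply: contrapT => hn.
apply: nQP => z Qz; apply: (eigen_separates pP pQ PQ) => // u hu Qu.
apply: contrapT => nPu; apply: hn; exists u; split=> //.
exact: eigen_normal hu.
Qed.

End Relations.

(** * The algebra K_n *)

Section KnGenerators.
Variables (k : fieldType) (n : nat) (p q : 'I_n -> k) (gamma : 'M[k]_n).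
Local Notation K := (Kn p q gamma).
Local Notation pi := (quot_proj (Kn_ideal p q gamma)).

Definition free_gen (t : 'I_n + 'I_n) : free_alg k n := << fmu t >>.

Lemma free_alg_generated : generates free_gen.
Proof.
move=> S S1 SD SZ SM a; rewrite (monalgE a).
apply: (big_ind S) => [||m _].
- by rewrite -(scale0r 1); apply: SZ.
- exact: SD.
have -> : << a@_m *g m >> = a@_m *: (<< m >> : free_alg k n).
  by apply/malgP => m'; rewrite [LHS]mcoeffU mcoeffZ mcoeffU1 mulr_natr.
apply: SZ; rewrite -[m]fmK; elim: (fmonom_val m) => [|t s IH].
  by have -> : << FMonom [::] >> = 1 :> free_alg k n by rewrite -fmoneE.
have -> : << FMonom (t :: s) >> = free_gen t * << FMonom s >>; last exact: SM.
by rewrite malgM_def fgmulUU mulr1 /free_gen fmuE -[RHS]/(<< fmmul _ _ >>) fmmulE.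
Qed.

Definition Kn_gen (t : 'I_n + 'I_n) : K := pi (free_gen t).

Lemma Kn_projM u v : (pi u : K) * (pi v : K) = pi (u * v).
Proof. exact/esym/quot_projM. Qed.

Lemma Kn_projD u v : (pi u : K) + (pi v : K) = pi (u + v).
Proof. exact/esym/(raddfD pi). Qed.

Lemma Kn_projZ c u : c *: (pi u : K) = pi (c *: u).
Proof. exact: Kn_scaleE. Qed.

Lemma Kn_generated : generates Kn_gen.
Proof.
move=> S S1 SD SZ SM a; rewrite -[a]quot_reprK.
move: (quot_repr a) => u; move: u; apply: free_alg_generated.
- exact: S1.
- by move=> u v Su Sv; rewrite -Kn_projD; apply: SD.
- by move=> c u Su; rewrite -Kn_projZ; apply: SZ.
by move=> t u Su; rewrite -Kn_projM; apply: (SM t).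
Qed.

Lemma Kn_relE u v : Kn_rel p q gamma (u - v) -> pi u = pi v.
Proof. by move=> h; apply/quot_projP => J [_]; apply. Qed.

Lemma Kn_gen_comm s t c :
  Kn_rel p q gamma (free_gen s * free_gen t - c *: (free_gen t * free_gen s)) ->
  Kn_gen s * Kn_gen t = c *: (Kn_gen t * Kn_gen s).
Proof. by rewrite /Kn_gen !Kn_projM Kn_projZ; exact: Kn_relE. Qed.

Lemma Kn_gen_xy i : Kn_gen (inl i) * Kn_gen (inr i)
  = q i *: (Kn_gen (inr i) * Kn_gen (inl i)) + Omega p q Kn_gen i.
Proof.
have -> : Omega p q Kn_gen i = pi (\sum_(l < n | (l < i)%N)
    (q l - p l) *: (free_y k l * free_x k l)).
  rewrite /Omega (raddf_sum pi); apply: eq_bigr => l _.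
  by rewrite /Kn_gen Kn_projM Kn_projZ.
rewrite /Kn_gen !Kn_projM Kn_projZ Kn_projD.
exact/Kn_relE/Kn_rel_xy.
Qed.

End KnGenerators.

Theorem theorem4p19 (k : fieldType) (n : nat) (n_gt0 : (0 < n)%N)
    (p q : 'I_n -> k) (gamma : 'M[k]_n)
    (p_neq0 : forall i, p i != 0) (q_neq0 : forall i, q i != 0)
    (p_neq_q : forall i, p i != q i)
    (gamma_neq0 : forall i j, gamma i j != 0)
    (gammaV : forall i j, gamma j i = (gamma i j)^-1)
    (gamma_diag : forall i, gamma i i = 1)
    (p_over_q_nonroot : forall (i : 'I_n) (m : nat), (0 < m)%N ->
       ~ m.-unity_root (p i / q i)) :
  normally_separated (Kn p q gamma).
Proof.
apply: (relations_normally_separated (g := Kn_gen p q gamma) p_neq0 q_neq0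
  gamma_neq0 gammaV).
- move=> i m; apply/eqP => e; apply: (p_over_q_nonroot i m.+1) => //.
  by apply/unity_rootP.
- by move=> i j; apply: Kn_gen_comm; exact: Kn_rel_yy.
- by move=> i j ij; apply: Kn_gen_comm; exact: Kn_rel_xy_lt.
- by move=> i j ij; apply: Kn_gen_comm; exact: Kn_rel_xy_gt.
- by move=> i j ij; apply: Kn_gen_comm; exact: Kn_rel_xx.
- exact: Kn_gen_xy.
exact: Kn_generated.
Qed.
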